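(* Consider Solution I, i.e. $\hat i=\arg\max_{1\le i\le L_S}Y_i$. Let $R_F,R_{s,N}>0$, $\gamma_{th}=2^{R_F}-1$, $\gamma_{s,N}=\frac{2^{R_{s,N}}-1}{\alpha_N}$, and, when $\gamma_{th}<\beta$, $\eta=\log_2\left(\frac{\alpha_F}{\alpha_F-\alpha_N\gamma_{th}}\right)$, with $R_{s,N}\neq\eta$ in that case. Then the secrecy outage probability $SOP_{N,I}$ of user $N$ (defined in the context, with transmitting antenna $\hat i$) is $$SOP_{N,I}=\begin{cases}1,&\gamma_{th}\ge\beta\\ \Lambda_{1,I}+\Lambda_{2,I}+\Lambda_{3,I},&\gamma_{th}<\beta,\end{cases}$$ where $$\Lambda_{1,I}=F_{Y_{\hat i},I}\left(\tfrac{A_{\gamma_{th}}}{\gamma_0}\right),$$ $$\Lambda_{2,I}=\begin{cases}0,&R_{s,N}<\eta\\ \left[F_{Y_{\hat i},I}\left(\tfrac{\gamma_{s,N}}{\gamma_0}\right)-F_{Y_{\hat i},I}\left(\tfrac{A_{\gamma_{th}}}{\gamma_0}\right)\right]F_{Z_{\hat i}}\left(\tfrac{A_{\gamma_{th}}}{\gamma_E}\right),&R_{s,N}>\eta,\end{cases}$$ $$\Lambda_{3,I}=B_{N,I}^{(1)}+\sum_{p=1}^{L_S}\sum_{\Delta_N=p}\sum_{m=0}^{\varphi_N}\sum_{n=0}^{a_E+m-1}\Psi_{N,I}\left[\frac{A_{\gamma_{th}}B_{N,I}^{(2)}}{\gamma_E}\right]^n e^{-\frac{A_{\gamma_{th}}B_{N,I}^{(2)}}{\gamma_E}},$$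 with $$B_{N,I}^{(1)}=\left[1-F_{Y_{\hat i},I}\left(\tfrac{A_{\gamma_{th}}}{\gamma_0}\right)\right]\left[1-F_{Z_{\hat i}}\left(\tfrac{A_{\gamma_{th}}}{\gamma_E}\right)\right],\qquad B_{N,I}^{(2)}=\frac{p\,m_N\gamma_E2^{R_{s,N}}}{\gamma_0\lambda_{NS}}+\frac{m_E}{\lambda_{ES}},$$ $$\Psi_{N,I}=\binom{\varphi_N}{m}\frac{\Phi_N\,\Gamma(a_E+m)\,m_E^{a_E}\left(2^{R_{s,N}}\gamma_E\right)^m\gamma_{s,N}^{\varphi_N-m}\,e^{-\frac{p\,m_N\gamma_{s,N}}{\gamma_0\lambda_{NS}}}}{n!\,\Gamma(a_E)\,\lambda_{ES}^{a_E}\,\gamma_0^{\varphi_N}\left[B_{N,I}^{(2)}\right]^{a_E+m}},$$ and $$F_{Y_{\hat i},I}(x)=1+\sum_{p=1}^{L_S}\sum_{\Delta_N=p}\Phi_Nx^{\varphi_N}e^{-\frac{p\,m_Nx}{\lambda_{NS}}},\qquad F_{Z_{\hat i}}(x)=1-\sum_{k=0}^{a_E-1}\frac{m_E^k}{k!\lambda_{ES}^k}x^ke^{-\frac{m_Ex}{\lambda_{ES}}}.$$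
   Context: A source $S$ with $L_S$ antennas transmits to a near user $N$ and a far user $F$ in the presence of an eavesdropper $E$, having $L_N,L_F,L_E$ antennas. For $U\in\{N,F,E\}$, $1\le i\le L_S$, $1\le j\le L_U$, the channel power gains $|h_{U_jS_i}|^2$ (from source antenna $i$ to antenna $j$ of $U$) are mutually independent; each is gamma distributed with shape $m_U\ge 1/2$ and mean $\lambda_{US}=\Omega_U/d_{US}^{\theta_{US}}>0$ (Nakagami-$m$ fading with mean fading power $\Omega_U$, distance $d_{US}$, path-loss exponent $\theta_{US}$). The numbers $a_U=m_UL_U$ are positive integers. Put $X_i=\sum_{j=1}^{L_F}|h_{F_jS_i}|^2$, $Y_i=\sum_{j=1}^{L_N}|h_{N_jS_i}|^2$, $Z_i=\sum_{j=1}^{L_E}|h_{E_jS_i}|^2$. Power allocation coefficients: $\alpha_F>\alpha_N>0$, $\alpha_F+\alpha_N=1$. Average transmit SNRs: $\gamma_0,\gamma_E>0$. Notation: $\beta=\alpha_F/\alpha_N$ and $A_x=\frac{x}{\alpha_F-\alpha_N x}$ for $x\neq\beta$. For a transmitting antenna $i$: $$\gamma_{NS_i}^{x_F}=\frac{\alpha_F\gamma_0Y_i}{\alpha_N\gamma_0Y_i+1},\quad \gamma_{NS_i}^{x_N}=\alpha_N\gamma_0Y_i,\quad \gamma_{ES_i}^{x_F}=\frac{\alpha_F\gamma_EZ_i}{\alpha_N\gamma_EZ_i+1},\quad \gamma_{ES_i}^{x_N}=\alpha_N\gamma_EZ_i.$$ With $C_{N,i}=\log_2(1+\gamma_{NS_i}^{x_N})$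 and $C_{S,i}=\max\left\{0,\log_2\frac{1+\gamma_{NS_i}^{x_N}}{1+\gamma_{ES_i}^{x_N}}\right\}$, the secrecy outage probability of $N$ is $$SOP_{N,i}=\Pr\{\gamma_{NS_i}^{x_F}<\gamma_{th}\}+\Pr\{\gamma_{NS_i}^{x_F}\ge\gamma_{th},\gamma_{ES_i}^{x_F}<\gamma_{th},C_{N,i}<R_{s,N}\}+\Pr\{\gamma_{NS_i}^{x_F}\ge\gamma_{th},\gamma_{ES_i}^{x_F}\ge\gamma_{th},C_{S,i}<R_{s,N}\},$$ and $SOP_{N,I}$ is this quantity with $i=\hat i$. The sum over $\Delta_N=p$ runs over all tuples $(\delta_{N,0},\dots,\delta_{N,a_N-1})$ of non-negative integers with $\Delta_N=\sum_{q=0}^{a_N-1}\delta_{N,q}=p$; for such a tuple, $\varphi_N=\sum_{q=0}^{a_N-1}q\,\delta_{N,q}$ and $$\Phi_N=\binom{L_S}{p}(-1)^p\binom{p}{\delta_{N,0},\dots,\delta_{N,a_N-1}}\prod_{q=0}^{a_N-1}\left(\frac{m_N^q}{q!\lambda_{NS}^q}\right)^{\delta_{N,q}}$$ (with multinomial coefficient). *)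

(* Defs.v *)
(* MathComp / MathComp-Analysis *)
From HB Require Import structures.
From mathcomp Require Export all_boot all_order all_algebra.
From mathcomp Require Export all_classical all_reals all_analysis.
Export Order.TTheory GRing.Theory Num.Theory numFieldNormedType.Exports.

Set Implicit Arguments.
Unset Strict Implicit.
Unset Printing Implicit Defensive.

Local Open Scope classical_set_scope.
Local Open Scope ring_scope.

Inductive user := Near | Far | Eve.

Definition user_code (U : user) : 'I_3 :=
  match U with Near => inord 0 | Far => inord 1 | Eve => inord 2 end.

Definition user_decode (k : 'I_3) : user :=
  match val k with 0%N => Near | 1%N => Far | _ => Eve end.

Lemma user_codeK : cancel user_code user_decode.
Proof. by case; rewrite /user_decode /= inordK. Qed.

HB.instance Definition _ := Finite.copy user (can_type user_codeK).

Section probability_notions.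
Context {R : realType}.

Definition log2 (x : R) : R := ln x / ln 2.

Definition Gamma (a : R) : R :=
  \int[lebesgue_measure]_(t in `]0, +oo[) (t `^ (a - 1) * expR (- t)).

Definition gamma_pdf (shape mean x : R) : R :=
  let rate := shape / mean in
  if 0 < x then
    rate `^ shape / Gamma shape * x `^ (shape - 1) * expR (- (rate * x))
  else 0.

Definition gamma_prob (shape mean : R) (A : set R) : \bar R :=
  (\int[lebesgue_measure]_(x in A) (gamma_pdf shape mean x)%:E)%E.

Definition mutually_independent (d : measure_display) (T : measurableType d)
    (P : probability T R) (I : finType) (X : I -> {RV P >-> R}) : Prop :=
  forall (J : {set I}) (B : I -> set R), (forall i, measurable (B i)) ->
    P (\bigcap_(i in [set` J]) (X i @^-1` B i)) =
    (\prod_(i in J) P (X i @^-1` B i))%E.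

End probability_notions.

(* [L_S] and [L_ U] count the antennas of the source and of [U]; [m_], [Omega],
   [dist], [pathloss] are the Nakagami parameter, mean fading power, distance
   to the source and path-loss exponent of the link from the source to [U]. *)
Record noma_system (R : realType) := NomaSystem {
  L_S : nat;
  L_ : user -> nat;
  m_ : user -> R;
  a_ : user -> nat;
  Omega : user -> R;
  dist : user -> R;
  pathloss : user -> R;
  alphaF : R;
  alphaN : R;
  gamma0 : R;
  gammaE : R;
  L_S_gt0 : (0 < L_S)%N;
  L_gt0 : forall U, (0 < L_ U)%N;
  m_ge : forall U, 1 / 2 <= m_ U;
  a_def : forall U, (a_ U)%:R = m_ U * (L_ U)%:R;
  a_gt0 : forall U, (0 < a_ U)%N;
  dist_gt0 : forall U, 0 < dist U;
  mean_gt0 : forall U, 0 < Omega U / dist U `^ pathloss U;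
  alphaN_gt0 : 0 < alphaN;
  alphaN_lt_alphaF : alphaN < alphaF;
  alphaFN : alphaF + alphaN = 1;
  gamma0_gt0 : 0 < gamma0;
  gammaE_gt0 : 0 < gammaE }.

Section parameters.
Context {R : realType}.
Variable s : noma_system R.

Definition lambda (U : user) : R := Omega s U / dist s U `^ pathloss s U.

Definition beta : R := alphaF s / alphaN s.

Definition A_ (x : R) : R := x / (alphaF s - alphaN s * x).

Definition gamma_th (RF : R) : R := 2 `^ RF - 1.

Definition gamma_sN (RsN : R) : R := (2 `^ RsN - 1) / alphaN s.

Definition eta (gth : R) : R :=
  log2 (alphaF s / (alphaF s - alphaN s * gth)).

End parameters.

Section model.
Context {R : realType}.
Variable s : noma_system R.
Context {d : measure_display} {T : measurableType d}.
Variable P : probability T R.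

(* [h U i j] is the power gain from source antenna [i] to antenna [j] of [U]. *)
Variable h : forall U : user, 'I_(L_S s) -> 'I_(L_ s U) -> {RV P >-> R}.
Arguments h : clear implicits.

Definition gains_gamma : Prop :=
  forall U i j (A : set R), measurable A ->
    distribution P (h U i j) A = gamma_prob (m_ s U) (lambda s U) A.

Definition gains_independent : Prop :=
  mutually_independent
    (fun k : {U : user & ('I_(L_S s) * 'I_(L_ s U))%type} =>
       h (tag k) (tagged k).1 (tagged k).2).

Definition total_gain (U : user) (i : 'I_(L_S s)) (w : T) : R :=
  \sum_(j < L_ s U) h U i j w.

(* Any measurable tie-breaking rule is allowed. *)
Definition solution_I (ihat : T -> 'I_(L_S s)) : Prop :=
  (forall i, measurable (ihat @^-1` [set i])) /\
  (forall w i, total_gain Near i w <= total_gain Near (ihat w) w).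

Definition snr_xF (g x : R) : R := alphaF s * g * x / (alphaN s * g * x + 1).

Definition snr_xN (g x : R) : R := alphaN s * g * x.

(* The transmitting antenna may depend on the outcome. *)
Variable sel : T -> 'I_(L_S s).

Definition gamma_N_xF (w : T) := snr_xF (gamma0 s) (total_gain Near (sel w) w).
Definition gamma_N_xN (w : T) := snr_xN (gamma0 s) (total_gain Near (sel w) w).
Definition gamma_E_xF (w : T) := snr_xF (gammaE s) (total_gain Eve (sel w) w).
Definition gamma_E_xN (w : T) := snr_xN (gammaE s) (total_gain Eve (sel w) w).

Definition C_N (w : T) : R := log2 (1 + gamma_N_xN w).

Definition C_S (w : T) : R :=
  Num.max 0 (log2 ((1 + gamma_N_xN w) / (1 + gamma_E_xN w))).

Definition SOP_N (gth RsN : R) : \bar R :=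
  (P [set w | (gamma_N_xF w < gth)%R]
   + P [set w | [/\ gth <= gamma_N_xF w, gamma_E_xF w < gth & C_N w < RsN]%R]
   + P [set w | [/\ gth <= gamma_N_xF w, gth <= gamma_E_xF w
                  & C_S w < RsN]%R])%E.

End model.

Section closed_form.
Context {R : realType}.
Variable s : noma_system R.

Local Notation mN := (m_ s Near).
Local Notation mE := (m_ s Eve).
Local Notation lN := (lambda s Near).
Local Notation lE := (lambda s Eve).
Local Notation aN := (a_ s Near).
Local Notation aE := (a_ s Eve).

(* A tuple of non-negative integers with sum [p] has all its entries at most
   [p], so it is an element of the finite type [{ffun 'I_aN -> 'I_p.+1}]. *)
Definition Delta_N p (dl : {ffun 'I_aN -> 'I_p.+1}) : nat :=
  (\sum_(q < aN) dl q)%N.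

Definition phi_N p (dl : {ffun 'I_aN -> 'I_p.+1}) : nat :=
  (\sum_(q < aN) q * dl q)%N.

Definition Phi_N p (dl : {ffun 'I_aN -> 'I_p.+1}) : R :=
  'C(L_S s, p)%:R * (-1) ^+ p
  * (p`!%:R / \prod_(q < aN) (dl q)`!%:R)
  * \prod_(q < aN) (mN ^+ q / (q`!%:R * lN ^+ q)) ^+ dl q.

Definition F_Y_I (x : R) : R :=
  1 + \sum_(1 <= p < (L_S s).+1)
        \sum_(dl : {ffun 'I_aN -> 'I_p.+1} | Delta_N dl == p)
          Phi_N dl * x ^+ phi_N dl * expR (- (p%:R * mN * x / lN)).

Definition F_Z (x : R) : R :=
  1 - \sum_(k < aE)
        mE ^+ k / (k`!%:R * lE ^+ k) * x ^+ k * expR (- (mE * x / lE)).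

Definition Lambda_1_I (gth : R) : R := F_Y_I (A_ s gth / gamma0 s).

(* The value at [RsN = eta s gth] is irrelevant. *)
Definition Lambda_2_I (gth RsN : R) : R :=
  if RsN < eta s gth then 0
  else (F_Y_I (gamma_sN s RsN / gamma0 s) - F_Y_I (A_ s gth / gamma0 s))
       * F_Z (A_ s gth / gammaE s).

Definition B1_N_I (gth : R) : R :=
  (1 - F_Y_I (A_ s gth / gamma0 s)) * (1 - F_Z (A_ s gth / gammaE s)).

Definition B2_N_I (p : nat) (RsN : R) : R :=
  p%:R * mN * gammaE s * 2 `^ RsN / (gamma0 s * lN) + mE / lE.

Definition Psi_N_I p (dl : {ffun 'I_aN -> 'I_p.+1}) (m n : nat) (RsN : R) : R :=
  'C(phi_N dl, m)%:R
  * (Phi_N dl * Gamma (aE + m)%:R * mE ^+ aE * (2 `^ RsN * gammaE s) ^+ m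
     * gamma_sN s RsN ^+ (phi_N dl - m)
     * expR (- (p%:R * mN * gamma_sN s RsN / (gamma0 s * lN))))
  / (n`!%:R * Gamma aE%:R * lE ^+ aE * gamma0 s ^+ phi_N dl
     * B2_N_I p RsN ^+ (aE + m)).

Definition Lambda_3_I (gth RsN : R) : R :=
  B1_N_I gth +
  \sum_(1 <= p < (L_S s).+1)
    \sum_(dl : {ffun 'I_aN -> 'I_p.+1} | Delta_N dl == p)
      \sum_(0 <= m < (phi_N dl).+1)
        \sum_(0 <= n < aE + m)
          Psi_N_I dl m n RsN
          * (A_ s gth * B2_N_I p RsN / gammaE s) ^+ n
          * expR (- (A_ s gth * B2_N_I p RsN / gammaE s)).

End closed_form.

(* Main.v *)
(* Up to a null event all gains are positive and the [Y_i] are distinct, so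
   [ihat] is a function of the gains to the near user alone.  Those are
   independent of the gains to the eavesdropper, hence [Z_ihat] is independent
   of [Y_ihat] and has the common law of the [Z_i].

   The law of a sum of [L] gains needs no Beta integral: the convolution of two
   gamma densities of the same rate is a constant times a gamma density, and the
   total mass forces the constant.  The shape [m L] being a positive integer,
   tails are truncated exponential sums; the multinomial theorem applied to the
   [L_S]-th power of [P(Y_i < x)] gives [F_Y_I], and the third outage event
   becomes a finite sum of integrals of [z ^ k e ^ (- B z)] over a half-line. *)

(* Independence is given for Borel events of single gains, whereas the event that antenna [i] is
   selected involves all gains to the near user. It is therefore carried over, by uniqueness of
   measures on a pi-system, to the sigma-algebras generated by disjoint sets of links. On ties
   [ihat] may depend on the eavesdropper, so [ihat = i] is traded for the event that [Y_i] is
   strictly the largest. On positive gains the outage conditions become bounds on [Y_ihat] and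
   [Z_ihat]: both decoding conditions cut at [A_] divided by the transmit SNR, and the rate
   conditions read [Y < g] and [Y < g + u Z] with [g = gamma_sN / gamma0] and
   [u = 2 ^ RsN * gammaE / gamma0]. The second event is empty below the rate [eta], where
   [gamma_sN < A_]. In the third event [2 ^ RsN > 1] keeps the upper bound on [Y] above the lower
   one, so its formula is the same on both sides of [eta]. *)
From HB Require Import structures.
Require Import Defs.
From mathcomp Require Import measurable_realfun ring.

Set Implicit Arguments.
Unset Strict Implicit.
Unset Printing Implicit Defensive.

Local Open Scope classical_set_scope.
Local Open Scope ring_scope.

(** * Integrals of x ^ n e ^ (- B x) *)

Section exponential_tail.
Context {R : realType}.
Local Notation mu := lebesgue_measure.

(* [P(N <= n)] for a Poisson variable [N] of mean [y], equivalently the upper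
   tail at [y] of the gamma law of shape [n.+1] and rate 1. *)
Definition exp_tail n (y : R) := expR (- y) * \sum_(k < n.+1) y ^+ k / k`!%:R.

Lemma exp_tail_at0 n : exp_tail n 0 = 1.
Proof.
rewrite /exp_tail oppr0 expR0 mul1r big_ord_recl/= big1 ?addr0 => [|i _].
  by rewrite expr0 fact0 divr1.
by rewrite expr0n mul0r.
Qed.

Lemma exp_tail0 : exp_tail 0 = (fun y => expR (- y) * (y ^+ 0 / 0`!%:R)).
Proof. by apply/funext => x; rewrite /exp_tail big_ord1. Qed.

Lemma exp_tailS n : exp_tail n.+1 =
  exp_tail n + (fun y => expR (- y) * (y ^+ n.+1 / (n.+1)`!%:R)).
Proof. by apply/funext => x; rewrite /exp_tail [LHS]/= big_ord_recr/= mulrDr. Qed.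

(** The derivatives of consecutive terms telescope and only the last one survives, so [- exp_tail n]
    is a primitive of the gamma density of shape [n.+1] and rate 1. *)
Lemma is_derive_exp_tail n y :
  is_derive (y : R) (1 : R) (exp_tail n) (- (expR (- y) * (y ^+ n / n`!%:R))).
Proof.
have h1 : is_derive (y : R) (1 : R) (expR \o -%R) (- expR (- y)).
  by rewrite -mulrN1; apply: is_derive1_comp.
elim: n => [|n IHn].
  rewrite (_ : exp_tail 0 = expR \o -%R); last first.
    by apply/funext => x; rewrite exp_tail0 expr0 fact0 divr1 mulr1.
  by rewrite expr0 fact0 divr1 mulr1.
have h2 : is_derive (y : R) (1 : R) (fun x : R => x ^+ n.+1 * (n.+1)`!%:R^-1)
    (y ^+ n / n`!%:R).
  have := is_deriveM (is_deriveX n.+1 (is_derive_id y (1 : R)))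
    (is_derive_cst ((n.+1)`!%:R^-1 : R) y (1 : R)).
  rewrite (_ : _ * _ = fun x : R => x ^+ n.+1 * (n.+1)`!%:R^-1); last first.
    by apply/funext => x; rewrite fctE exprfctE.
  move/is_derive_eq; apply; rewrite /GRing.scale/= factS natrM; field.
  by rewrite nat1r !pnatr_eq0 -!lt0n fact_gt0.
have -> : exp_tail n.+1 =
    exp_tail n + (expR \o -%R) * (fun x => x ^+ n.+1 * (n.+1)`!%:R^-1).
  by rewrite exp_tailS.
have := is_deriveD IHn (is_deriveM h1 h2).
move/is_derive_eq; apply; rewrite /GRing.scale/=.
ring.
Qed.

Lemma cvg_exp_tail n : exp_tail n y @[y --> +oo] --> 0.
Proof.
have cvg1 k : (expR (- y) * (y ^+ k / k`!%:R)) @[y --> +oo%R] --> (0 : R).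
  (* The bound [(k + 1) / y] comes from [e ^ y > y ^ (k + 1) / (k + 1)!]. *)
  apply: (@squeeze_cvgr _ _ _ _ (cst 0) (fun y => k.+1%:R * y^-1)).
  - near=> y.
    have y0 : 0 < y by near: y; exact: nbhs_pinfty_gt.
    apply/andP; split; first by rewrite mulr_ge0 ?expR_ge0 ?divr_ge0 ?exprn_ge0 ?ltW.
    rewrite expRN [leLHS]mulrC ler_pdivrMr ?expR_gt0//.
    have := expR_ge1Dxn k (ltW y0) => h.
    apply: (@le_trans _ _ (k.+1%:R / y * (y ^+ k.+1 / k.+1`!%:R))); last first.
      by rewrite ler_wpM2l ?divr_ge0// ltW// (lt_le_trans _ h)// ltrDr.
    rewrite exprS factS natrM le_eqVlt; apply/orP; left; apply/eqP; field.
    by rewrite !nat1r !pnatr_eq0 -!lt0n !fact_gt0 gt_eqF.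
  - exact: cvg_cst.
  - rewrite -(mulr0 (k.+1%:R : R)); apply: cvgM; first exact: cvg_cst.
    by apply/gtr0_cvgV0; [exact: nbhs_pinfty_gt|exact: cvg_id].
elim: n => [|n IHn]; first by rewrite exp_tail0; exact: cvg1.
by rewrite exp_tailS -(addr0 (0 : R)); apply: cvgD => //; exact: cvg1.
Unshelve. all: by end_near. Qed.

Lemma measurable_exprn_expR n (B : R) :
  measurable_fun setT (fun x : R => x ^+ n * expR (- (B * x))).
Proof.
apply: measurable_funM => //; apply: measurableT_comp => //.
by apply: measurableT_comp => //; exact: measurable_funM.
Qed.

Lemma integral_exp_tail n (B z : R) : 0 < B -> 0 <= z ->
  (\int[mu]_(x in `[z, +oo[) (x ^+ n * expR (- (B * x)))%:E =
   (n`!%:R / B ^+ n.+1 * exp_tail n (B * z))%:E)%E.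
Proof.
move=> B0 z0.
(* A primitive of the integrand that vanishes at infinity, so that the integral is [- F z]. *)
pose F x := - (n`!%:R / B ^+ n.+1) * exp_tail n (B * x).
have dF x : is_derive (x : R) (1 : R) F (x ^+ n * expR (- (B * x))).
  have h1 : is_derive (x : R) (1 : R) ( *%R B) B.
    have := is_deriveZ B (is_derive_id x (1 : R)).
    by move/is_derive_eq; apply; rewrite /GRing.scale/= mulr1.
  have h := is_derive1_comp (is_derive_exp_tail n (B * x)) h1.
  have := is_deriveZ (- (n`!%:R / B ^+ n.+1)) h.
  move/is_derive_eq; apply; rewrite /GRing.scale/= exprMn exprS; field.
  by rewrite expf_neq0 ?gt_eqF//= pnatr_eq0 -lt0n fact_gt0.
have cF : continuous F.
  by move=> x; apply/differentiable_continuous/derivable1_diffP; have [] := dF x.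
have cf : continuous (fun x : R => x ^+ n * expR (- (B * x))).
  move=> x; apply: cvgM; first exact: exprn_continuous.
  apply: continuous_comp; last exact: continuous_expR.
  by apply: cvgN; apply: cvgM; [exact: cvg_cst|exact: cvg_id].
rewrite (@ge0_continuous_FTC2y _ _ F _ 0).
- by rewrite /F mulNr EFinN oppeK add0e.
- by move=> x zx; rewrite mulr_ge0 ?exprn_ge0 ?expR_ge0 ?(le_trans z0).
- exact: continuous_subspaceT.
- rewrite -(mulr0 (- (n`!%:R / B ^+ n.+1))); apply: cvgM; first exact: cvg_cst.
  apply: (@cvg_comp _ _ _ ( *%R B) (exp_tail n)); last exact: cvg_exp_tail.
  exact: gt0_cvgMry.
- by move=> x _; have := dF x; case.
- by apply/cvg_at_right_filter/cF.
- by move=> x _; rewrite derive1E (@derive_val _ _ _ _ _ _ _ (dF x)).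
Qed.

End exponential_tail.

(** * The multinomial theorem over tuples of bounded exponents *)

Section multinomial.
Context {R : numFieldType}.

(* Both sides, divided by [p!], are the coefficient of ['X^p] in a product of
   truncated exponential series. *)
Let texp p (x : R) : {poly R} := \poly_(k < p.+1) (x ^+ k / k`!%:R).

(** Exponential series multiply by adding their arguments, and truncation at degree [p] does not
    affect coefficients of degree at most [p]. The induction step is the binomial theorem. *)
Lemma coef_prod_texp (I : Type) (r : seq I) (x : I -> R) p k : (k <= p)%N ->
  (\prod_(q <- r) texp p (x q))`_k = (\sum_(q <- r) x q) ^+ k / k`!%:R.
Proof.
elim: r k => [|q r IHr] k kp.
  by rewrite !big_nil coef1 expr0n; case: k {kp} => [|k]; rewrite ?fact0 ?divr1 ?mul0r.
rewrite !big_cons coefMr exprDn mulr_suml; apply: eq_bigr => -[i /= ik] _.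
have kip : (k - i < p.+1)%N by rewrite ltnS (leq_trans (leq_subr _ _)).
rewrite coef_poly kip IHr; last by rewrite (leq_trans _ kp).
rewrite -mulr_natr -(bin_fact (ik : i <= k)%N) !natrM.
field.
by rewrite !pnatr_eq0 -!lt0n !fact_gt0 bin_gt0.
Qed.

Lemma multinomial_expansion n p (x : 'I_n -> R) :
  (\sum_(q < n) x q) ^+ p =
  \sum_(f : {ffun 'I_n -> 'I_p.+1} | (\sum_(q < n) f q)%N == p)
    p`!%:R / (\prod_(q < n) (f q)`!%:R) * \prod_(q < n) x q ^+ f q.
Proof.
have p0 : p`!%:R != 0 :> R by rewrite pnatr_eq0 -lt0n fact_gt0.
apply: (mulIf (invr_neq0 p0)); rewrite -(coef_prod_texp _ _ (leqnn p)) mulr_suml.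
rewrite /texp; under eq_bigr do rewrite poly_def.
(* Choosing one of the [p.+1] terms in each factor is choosing a function [f]; it contributes a
   monomial of degree [\sum_q f q], and the coefficient of degree [p] selects the tuples of sum
   [p]. *)
rewrite bigA_distr_bigA coef_sum [RHS]big_mkcond/=; apply: eq_bigr => f _.
rewrite (_ : \prod_i _ =
  (\prod_q (x q ^+ f q / (f q)`!%:R)) *: 'X^(\sum_(q < n) f q)); last first.
  rewrite -prodrXr -mul_polyC rmorph_prod -big_split/=.
  by apply: eq_bigr => i _; rewrite mul_polyC.
rewrite coefZ coefXn eq_sym; case: eqP => _; last by rewrite mulr0.
rewrite prodf_div mulr1; field; rewrite p0.
by apply/prodf_neq0 => i _; rewrite pnatr_eq0 -lt0n fact_gt0.
Qed.

End multinomial.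

(** * The distribution functions of the statement as exponential tails *)

Section channel_parameters.
Context {R : realType} (s : noma_system R).
Local Notation rate U := (m_ s U / lambda s U).

Lemma m_gt0 U : 0 < m_ s U.
Proof. by rewrite (lt_le_trans _ (m_ge s U))// divr_gt0. Qed.

Lemma lambda_neq0 U : lambda s U != 0.
Proof. by rewrite gt_eqF// mean_gt0. Qed.

Lemma rate_gt0 U : 0 < rate U.
Proof. by rewrite divr_gt0 ?m_gt0 ?mean_gt0. Qed.

(** The right-hand side is expanded by the binomial theorem, whose term [p = 0] is the leading 1,
    and then each [p]-th power of the tail over tuples; [phi_N] collects the powers of [x]. As
    [exp_tail n] has [n.+1] terms, its index is [a_N - 1]. *)
Lemma F_Y_I_exp_tail x :
  F_Y_I s x = (1 - exp_tail (a_ s Near).-1 (rate Near * x)) ^+ L_S s.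
Proof.
have l0 := lambda_neq0 Near.
rewrite /F_Y_I /exp_tail prednK ?a_gt0// exprDn.
rewrite -[RHS](big_mkord xpredT (fun i =>
  (1 ^+ (L_S s - i) * (- _) ^+ i) *+ 'C(L_S s, i))) big_nat_recl//=.
rewrite expr1n expr0 mulr1 bin0; congr (_ + _).
rewrite big_add1/=; apply: eq_big_nat => p _.
rewrite expr1n mul1r exprNn exprMn multinomial_expansion.
rewrite -[RHS]mulr_natr 2!mulr_sumr big_distrl/=.
rewrite (_ : expR _ ^+ p.+1 =
  expR (- (p.+1%:R * m_ s Near * x / lambda s Near))); last first.
  by rewrite -expRM_natl; congr expR; field.
apply: eq_bigr => f _.
rewrite /Phi_N (_ : \prod_(q < a_ s Near) ((_ * x) ^+ q / _) ^+ f q =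
  x ^+ phi_N f *
  \prod_(q < a_ s Near) (m_ s Near ^+ q / (q`!%:R * lambda s Near ^+ q)) ^+ f q).
  by ring.
rewrite /phi_N -prodrXr -big_split/=; apply: eq_bigr => q _.
rewrite exprM -exprMn; congr (_ ^+ _).
rewrite exprMn expr_div_n; field.
by rewrite expf_neq0// pnatr_eq0 -lt0n fact_gt0.
Qed.

Lemma F_Z_exp_tail x : F_Z s x = 1 - exp_tail (a_ s Eve).-1 (rate Eve * x).
Proof.
rewrite /F_Z /exp_tail prednK ?a_gt0//; congr (1 - _).
rewrite mulr_sumr; apply: eq_bigr => k _.
rewrite (_ : m_ s Eve * x / lambda s Eve = rate Eve * x); last by ring.
move: (lambda s Eve) (lambda_neq0 Eve) => l l0.
rewrite 2!exprMn exprVn; field.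
by rewrite expf_neq0//= pnatr_eq0 -lt0n fact_gt0.
Qed.

End channel_parameters.

(** * Densities and substitutions *)

Section density.
Context {d : measure_display} {T : measurableType d} {R : realType}.
Variables (mu nu : {measure set T -> \bar R}) (f : T -> R).
Hypothesis f0 : forall x, 0 <= f x.
Hypothesis mf : measurable_fun setT f.
Hypothesis nuE : forall A, measurable A -> nu A = (\int[mu]_(x in A) (f x)%:E)%E.
Local Open Scope ereal_scope.
Import HBNNSimple.

Let mEf : measurable_fun setT (EFin \o f).
Proof. exact/measurable_EFinP. Qed.

Let integral_density_indic (k : R) (A : set T) : (0 <= k)%R -> measurable A ->
  \int[nu]_x (k * \1_A x)%:E = \int[mu]_x ((k * \1_A x)%:E * (f x)%:E).
Proof.
move=> k0 mA.
have mI : measurable_fun setT (EFin \o (\1_A : T -> R)) by exact/measurable_EFinP.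
under eq_integral do rewrite EFinM.
rewrite ge0_integralZl//.
rewrite integral_indic// setIT nuE// integral_mkcond.
under [RHS]eq_integral do rewrite EFinM -muleA.
rewrite ge0_integralZl//.
- congr (_ * _); apply: eq_integral => x _; rewrite patchE indicE.
  by case: (x \in A); rewrite ?mul1e ?mul0e.
- exact: emeasurable_funM.
- by move=> x _; rewrite mule_ge0// lee_fin.
Qed.

Let integral_density_nnsfun (g : {nnsfun T >-> R}) :
  \int[nu]_x (g x)%:E = \int[mu]_x ((g x)%:E * (f x)%:E).
Proof.
under eq_integral do rewrite fimfunE -fsumEFin//.
rewrite ge0_integral_fsum//; last 2 first.
- by move=> r; exact/measurable_EFinP/measurable_funM.
- by move=> r x _; rewrite nnfun_muleindic_ge0.
transitivity (\int[mu]_x (\sum_(r \in range g)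
    ((r * \1_(g @^-1` [set r]) x)%:E * (f x)%:E))); last first.
  apply: eq_integral => x _; rewrite fimfunE -fsumEFin// ge0_mule_fsuml//.
  by move=> r; rewrite nnfun_muleindic_ge0.
rewrite ge0_integral_fsum//; last 2 first.
- move=> r; apply: emeasurable_funM => //; exact/measurable_EFinP/measurable_funM.
- by move=> r x _; rewrite mule_ge0 ?nnfun_muleindic_ge0// lee_fin.
apply: eq_fsbigr => r /[!inE] -[x _ <-].
by apply: integral_density_indic.
Qed.

(** The density is only known to give the measure of sets, that is, the integral of indicators;
    linearity extends this to simple functions, monotone convergence to [g]. *)
Lemma ge0_integral_density (g : T -> \bar R) : measurable_fun setT g ->
  (forall x, 0 <= g x) -> \int[nu]_x g x = \int[mu]_x (g x * (f x)%:E).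
Proof.
move=> mg g0; pose h := nnsfun_approx measurableT mg.
have gE x : (h n x)%:E @[n --> \oo] --> g x by exact: cvg_nnsfun_approx.
have hnd x : {homo (fun n => (h n x)%:E) : m n / (m <= n)%N >-> m <= n}.
  by move=> m n mn; rewrite lee_fin; exact/lefP/nd_nnsfun_approx.
transitivity (limn (fun n => \int[nu]_x (h n x)%:E)).
  rewrite -monotone_convergence//.
  - by apply: eq_integral => x _; apply/esym/cvg_lim => //; exact: gE.
  - by move=> n; exact/measurable_EFinP.
  - by move=> n x _; rewrite lee_fin.
transitivity (limn (fun n => \int[mu]_x ((h n x)%:E * (f x)%:E))).
  by congr (limn _); apply/funext => n; rewrite integral_density_nnsfun.
rewrite -monotone_convergence//.
- by apply: eq_integral => x _; apply/cvg_lim => //; apply: cvgeZr => //; exact: gE.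
- by move=> n; apply: emeasurable_funM => //; exact/measurable_EFinP.
- by move=> n x _; rewrite mule_ge0// lee_fin.
- by move=> x _ m n mn; rewrite lee_wpmul2r ?lee_fin//; exact/lefP/nd_nnsfun_approx.
Qed.

End density.

Section affine_substitution.
Context {R : realType}.
Local Notation mu := (@lebesgue_measure R).
Local Open Scope ereal_scope.

Lemma ge0_integral_affine (c v : R) (G : R -> \bar R) : (0 < c)%R ->
  measurable_fun setT G -> (forall x, 0 <= G x) ->
  \int[mu]_x G x = c%:E * \int[mu]_x G (c * x + v)%R.
Proof.
move=> c0 mG G0.
pose phi (x : R) := (c * x + v)%R.
have mphi : measurable_fun setT (phi : measurableTypeR R -> measurableTypeR R).
  by apply: measurable_funD => //; exact: measurable_funM.
pose phi' : {mfun measurableTypeR R >-> measurableTypeR R} :=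
  HB.pack phi (isMeasurableFun.Build _ _ _ _ _ mphi).
pose m : {measure set (measurableTypeR R) -> \bar R} := pushforward mu phi'.
pose m1 : {measure set (measurableTypeR R) -> \bar R} :=
  mscale (NngNum (ltW c0)) (m mphi).
(* The image of Lebesgue measure under [x |-> c x + v], multiplied by [c], is again Lebesgue
   measure: it suffices to compare them on half-open intervals. *)
have mE A : measurable A -> mu A = m1 A.
  apply: lebesgue_measure_unique => _ [[a b]] _ <-.
  rewrite lebesgue_measure_itv/= /m1 /m /mscale/= /pushforward.
  rewrite (_ : phi @^-1` _ = `]((a - v) / c)%R, ((b - v) / c)%R]%classic); last first.
    apply/seteqP; split => x /=;
    by rewrite !in_itv/= ltr_pdivrMr// ler_pdivlMr// ltrBlDr lerBrDr mulrC.
  rewrite lebesgue_measure_itv/= !lte_fin ltr_pM2r ?invr_gt0// ltrD2r.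
  case: ifPn => ab; last by rewrite mule0.
  by rewrite -EFinM; congr EFin; field; rewrite gt_eqF.
have <- : \int[m mphi]_x G x = \int[mu]_x G (c * x + v)%R.
  by rewrite ge0_integral_pushforward// => y _; exact: G0.
transitivity (\int[m1]_x G x); last by rewrite ge0_integral_mscale.
by apply: eq_measure_integral => A mA _; exact: mE.
Qed.

End affine_substitution.

(** * Independence *)

Section joint_law.
Context {R : realType} {d : measure_display} {T : measurableType d}.
Variables (P : probability T R) (U V : T -> R).
Hypotheses (mU : measurable_fun setT U) (mV : measurable_fun setT V).

Definition independent_pair := forall A B : set R, measurable A -> measurable B ->
  P (U @^-1` A `&` V @^-1` B) = (P (U @^-1` A) * P (V @^-1` B))%E.

Let U' : {RV P >-> R} := HB.pack U (isMeasurableFun.Build _ _ _ _ _ mU).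
Let V' : {RV P >-> R} := HB.pack V (isMeasurableFun.Build _ _ _ _ _ mV).

Lemma measurable_prob_section (C : set (R * R)) : measurable C ->
  measurable_fun setT (fun y => P (U @^-1` [set x | C (y, x)])).
Proof.
move=> mC; have := measurable_fun_xsection (distribution P U') mC.
congr measurable_fun; apply/funext => y; congr (P (U @^-1` _)).
by apply/seteqP; split => x /=; rewrite /xsection/= inE.
Qed.

(** By independence the joint law agrees with the product of the laws on rectangles, hence on all
    measurable sets, and a product measure integrates the measures of sections. *)
Lemma independent_pair_prob (C : set (R * R)) : independent_pair -> measurable C ->
  P [set w | C (V w, U w)] = (\int[P]_w P (U @^-1` [set x | C (V w, x)]))%E.
Proof.
move=> indUV mC.
have mVU : measurable_fun setT (fun w => (V w, U w)).
  exact: measurable_fun_pair.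
pose VU : {mfun T >-> (R * R)%type} :=
  HB.pack (fun w => (V w, U w)) (isMeasurableFun.Build _ _ _ _ _ mVU).
transitivity ((distribution P VU) C) => //.
rewrite -(@product_measure_unique _ _ _ _ R
  (distribution P V') (distribution P U'))//=; last first.
  by move=> A B mA mB; rewrite [RHS]muleC -[RHS]indUV// setIC.
rewrite -[RHS](@ge0_integral_distribution _ _ _ _ _ P V'
  (fun y => P (U @^-1` [set x | C (y, x)])))//; last exact: measurable_prob_section.
apply: eq_integral => y _ /=; congr (P (U @^-1` _)).
by apply/seteqP; split => x /=; rewrite /xsection/= inE.
Qed.

End joint_law.

Section independence.
Context {R : realType} {d : measure_display} {T : measurableType d}.
Variables (P : probability T R) (I : finType) (X : I -> {RV P >-> R}).

(** A pi-system generating the sigma-algebra of the variables indexed by [S]; mutual independence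
    factors the probability of each of its members. *)
Definition cylinder (S : {set I}) : set_system T :=
  [set A | exists2 B : I -> set R, (forall i, measurable (B i)) &
    A = \bigcap_(i in [set` S]) (X i @^-1` B i)].

Lemma cylinderI S : setI_closed (cylinder S).
Proof.
move=> _ _ [B mB ->] [C mC ->].
exists (fun i => B i `&` C i) => [i|]; first exact: measurableI.
by rewrite -bigcapI; apply: eq_bigcapr => i _.
Qed.

Lemma cylinderT S : cylinder S setT.
Proof. by exists (fun=> setT) => //; rewrite bigcapT. Qed.

Lemma cylinder_measurable S : cylinder S `<=` measurable.
Proof.
move=> _ [B mB ->]; apply: fin_bigcap_measurable => //.
by move=> i _; exact: measurable_funPTI.
Qed.

Lemma sigma_cylinder_measurable S : <<s cylinder S >> `<=` measurable.
Proof.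
apply: smallest_sub; first exact: sigma_algebra_measurable.
exact: cylinder_measurable.
Qed.

Lemma sigma_cylinder_preimage (S : {set I}) i (B : set R) : i \in S -> measurable B ->
  <<s cylinder S >> (X i @^-1` B).
Proof.
move=> iS mB; apply: sub_sigma_algebra; exists (fun j => if j == i then B else setT).
  by move=> j; case: ifP.
apply/seteqP; split => [w Bw j _ /=|w /(_ i iS)/=]; last by rewrite eqxx.
by case: eqP => // ->.
Qed.

(** Expresses that [f] depends on the variables indexed by [S] alone. *)
Definition cylinder_measurable_fun (S : {set I}) (f : T -> R) :=
  forall B : set R, measurable B -> <<s cylinder S >> (f @^-1` B).

Lemma cylinder_measurable_funP S f : cylinder_measurable_fun S f <->
  measurable_fun setT (f : g_sigma_algebraType (cylinder S) -> R).
Proof.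
split=> [mf _ B mB|mf B mB]; first by rewrite setTI; exact: mf.
by have := mf measurableT B mB; rewrite setTI.
Qed.

Lemma cylinder_measurable_fun_measurable S f :
  cylinder_measurable_fun S f -> measurable_fun setT f.
Proof.
move=> mf _ B mB; rewrite setTI.
by apply: (@sigma_cylinder_measurable S); exact: mf.
Qed.

Lemma sigma_cylinderS (S1 S2 : {set I}) : {subset S1 <= S2} ->
  <<s cylinder S1 >> `<=` <<s cylinder S2 >>.
Proof.
move=> S12; apply: smallest_sub.
  exact: (@smallest_sigma_algebra _ setT (cylinder S2)).
move=> _ [B mB ->]; apply: sub_sigma_algebra.
exists (fun i => if i \in S1 then B i else setT).
  by move=> i; case: ifP.
apply/seteqP; split => [w Bw i iS2 /=|w Bw i iS1].
  by case: ifP => // iS1; exact: Bw.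
by have /= := Bw i (S12 _ iS1); rewrite iS1.
Qed.

Lemma cylinder_measurable_sum (J : Type) (S : {set I}) (f : J -> I) (r : seq J) :
  (forall j, f j \in S) ->
  cylinder_measurable_fun S (fun w => \sum_(j <- r) X (f j) w).
Proof.
move=> fS; apply/cylinder_measurable_funP; apply: measurable_sum => j.
by apply/cylinder_measurable_funP => B; exact: sigma_cylinder_preimage.
Qed.

Hypothesis indX : mutually_independent X.

Let indep_cylinder (S1 S2 : {set I}) A1 A2 :
  (forall i, i \in S1 -> i \notin S2) ->
  cylinder S1 A1 -> cylinder S2 A2 -> P (A1 `&` A2) = (P A1 * P A2)%E.
Proof.
move=> dS [B1 mB1 ->] [B2 mB2 ->].
(* As [S1] and [S2] are disjoint, the two families of Borel sets merge into one, and independence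
   applies to [S1], to [S2] and to their union. *)
pose B i := if i \in S1 then B1 i else B2 i.
have mB i : measurable (B i) by rewrite /B; case: ifP.
have inS2 i : i \in S2 -> (i \in S1) = false.
  by move=> iS2; apply/negbTE; apply: contraTN iS2 => /dS.
have -> : \bigcap_(i in [set` S1]) (X i @^-1` B1 i) =
          \bigcap_(i in [set` S1]) (X i @^-1` B i).
  by apply: eq_bigcapr => i /= iS; rewrite /B iS.
have -> : \bigcap_(i in [set` S2]) (X i @^-1` B2 i) =
          \bigcap_(i in [set` S2]) (X i @^-1` B i).
  by apply: eq_bigcapr => i /= iS; rewrite /B inS2.
rewrite -bigcap_setU (_ : [set` S1] `|` [set` S2] = [set` S1 :|: S2]); last first.
  by apply/seteqP; split => i /=; rewrite inE => /orP.
rewrite !indX// (eq_bigl [predU S1 & S2]) => [|i]; last by rewrite !inE.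
rewrite bigU//=.
by apply/pred0P => i /=; apply/negP => /andP[/dS/negP].
Qed.

(** For fixed [A2], the finite measures [A |-> P (A & A2)] and [A |-> P A * P A2] agree on the
    cylinders over [S1], hence on the sigma-algebra they generate. *)
Let indep_sigma_l (S1 S2 : {set I}) A1 A2 :
  (forall i, i \in S1 -> i \notin S2) ->
  <<s cylinder S1 >> A1 -> cylinder S2 A2 -> P (A1 `&` A2) = (P A1 * P A2)%E.
Proof.
move=> dS sA1 cA2; have mA2 := cylinder_measurable cA2.
have PA2 : (0 <= fine (P A2)) by exact: fine_ge0.
rewrite muleC -[X in (X * _)%E]fineK ?fin_num_measure//.
pose m1 : {measure set T -> \bar R} := mrestr P mA2.
pose m2 : {measure set T -> \bar R} := mscale (NngNum PA2) P.
rewrite -[LHS]/(m1 A1) -[RHS]/(m2 A1).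
apply: (g_sigma_algebra_measure_unique (cylinder S1) _ (fun=> setT)) => //.
- exact: cylinder_measurable.
- by move=> _; exact: cylinderT.
- by rewrite bigcup_const.
- exact: cylinderI.
- move=> A cA; change (P (A `&` A2) = ((fine (P A2))%:E * P A)%E).
  rewrite (indep_cylinder dS cA cA2).
  by rewrite fineK ?fin_num_measure// muleC.
- move=> _; change (P (setT `&` A2) < +oo)%E.
  by rewrite setTI -ge0_fin_numE// fin_num_measure.
Qed.

(** The same uniqueness argument in the second event, the first one being already arbitrary in its
    sigma-algebra. *)
Lemma indep_sigma_cylinder (S1 S2 : {set I}) A1 A2 :
  (forall i, i \in S1 -> i \notin S2) ->
  <<s cylinder S1 >> A1 -> <<s cylinder S2 >> A2 ->
  P (A1 `&` A2) = (P A1 * P A2)%E.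
Proof.
move=> dS sA1 sA2; have mA1 := sigma_cylinder_measurable sA1.
have PA1 : (0 <= fine (P A1)) by exact: fine_ge0.
rewrite setIC -[X in (X * _)%E]fineK ?fin_num_measure//.
pose m1 : {measure set T -> \bar R} := mrestr P mA1.
pose m2 : {measure set T -> \bar R} := mscale (NngNum PA1) P.
rewrite -[LHS]/(m1 A2) -[RHS]/(m2 A2).
apply: (g_sigma_algebra_measure_unique (cylinder S2) _ (fun=> setT)) => //.
- exact: cylinder_measurable.
- by move=> _; exact: cylinderT.
- by rewrite bigcup_const.
- exact: cylinderI.
- move=> A cA; change (P (A `&` A1) = ((fine (P A1))%:E * P A)%E).
  rewrite setIC (indep_sigma_l dS sA1 cA).
  by rewrite fineK ?fin_num_measure// muleC.
- move=> _; change (P (setT `&` A1) < +oo)%E.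
  by rewrite setTI -ge0_fin_numE// fin_num_measure.
Qed.

Lemma indep_cylinder_fun (S1 S2 : {set I}) f1 f2 :
  (forall i, i \in S1 -> i \notin S2) ->
  cylinder_measurable_fun S1 f1 -> cylinder_measurable_fun S2 f2 ->
  independent_pair P f1 f2.
Proof.
move=> dS mf1 mf2 A B mA mB.
by apply: (indep_sigma_cylinder dS); [exact: mf1|exact: mf2].
Qed.

End independence.

(** * Sums of gamma variables *)

Section gamma_density.
Context {R : realType}.
Local Notation mu := (@lebesgue_measure R).
Implicit Types c s r x : R.

(** The constant [c] is left free, so that convolution can stay within the family without its
    normalization being known. *)
Definition gamma_density c s r x : R :=
  if 0 < x then c * x `^ (s - 1) * expR (- (r * x)) else 0.

Lemma gamma_density_ge0 c s r x : 0 <= c -> 0 <= gamma_density c s r x.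
Proof.
move=> c0; rewrite /gamma_density; case: ifP => // _.
by rewrite !mulr_ge0 ?powR_ge0 ?expR_ge0.
Qed.

Lemma measurable_gamma_density c s r : measurable_fun setT (gamma_density c s r).
Proof.
apply: measurable_fun_ifT => //; first exact: measurable_fun_ltr.
apply: measurable_funM.
  by apply: measurable_funM => //; exact: measurable_powR.
by apply: measurableT_comp => //; apply: measurableT_comp => //; exact: measurable_funM.
Qed.

Let beta_kernel s1 s2 (t : R) : R :=
  if (0 < t) && (t < 1) then (1 - t) `^ (s1 - 1) * t `^ (s2 - 1) else 0.

Let measurable_beta_kernel s1 s2 : measurable_fun setT (beta_kernel s1 s2).
Proof.
apply: measurable_fun_ifT => //.
  by apply: measurable_and; exact: measurable_fun_ltr.
apply: measurable_funM; last exact: measurable_powR.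
apply: (measurableT_comp (measurable_powR (s1 - 1))).
exact: measurable_funB.
Qed.

(** After the substitution [v = w t], the equal rates make the exponentials multiply to
    [e ^ (- r w)], free of [t], and the powers of [w] gather into [w ^ (s1 + s2 - 1)]; only the Beta
    integrand still involves [t]. *)
Let gamma_density_convolution_scaled c1 c2 s1 s2 r (w t : R) : 0 < w ->
  w * (gamma_density c1 s1 r (w - w * t) * gamma_density c2 s2 r (w * t)) =
  gamma_density (c1 * c2) (s1 + s2) r w * beta_kernel s1 s2 t.
Proof.
move=> w0; rewrite /gamma_density /beta_kernel w0 subr_gt0 gtr_pMr// pmulr_rgt0//.
have [t0|] := ltP 0 t; last by rewrite !mulr0.
have [t1|] := ltP t 1; last by rewrite mul0r !mulr0.
rewrite (_ : w - w * t = w * (1 - t)); last by ring.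
rewrite !powRM ?subr_ge0 ?ltW//.
have wD (u v : R) : (u + v == 0) ==> (w != 0) by rewrite (gt_eqF w0) implybT.
have -> : w `^ (s1 + s2 - 1) = w * w `^ (s1 - 1) * w `^ (s2 - 1).
  have -> : s1 + s2 - 1 = 1 + ((s1 - 1) + (s2 - 1)) by ring.
  by rewrite (powRD (wD 1 _)) (powRD (wD (s1 - 1) _)) powRr1 ?ltW// mulrA.
have -> : expR (- (r * w)) = expR (- (r * (w * (1 - t)))) * expR (- (r * (w * t))).
  by rewrite -expRD; congr expR; ring.
rewrite /=; ring.
Qed.

(* [K] is the Beta integral, but neither its value nor its finiteness is known here. *)
Lemma gamma_density_convolution c1 c2 s1 s2 r : 0 <= c1 -> 0 <= c2 ->
  exists2 K : \bar R, (0 <= K)%E & forall w,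
  (\int[mu]_v (gamma_density c1 s1 r (w - v) * gamma_density c2 s2 r v)%:E =
   K * (gamma_density (c1 * c2) (s1 + s2) r w)%:E)%E.
Proof.
move=> c10 c20.
have b0 t : 0 <= beta_kernel s1 s2 t.
  by rewrite /beta_kernel; case: ifP => // _; rewrite mulr_ge0 ?powR_ge0.
exists (\int[mu]_t (beta_kernel s1 s2 t)%:E)%E.
  by apply: integral_ge0 => t _; rewrite lee_fin.
move=> w; have [w0|w0] := ltP 0 w; last first.
  rewrite integral0_eq => [|v _].
    by rewrite /gamma_density ltNge w0/= mule0.
  rewrite /gamma_density; case: ifPn; case: ifPn => v0 wv; rewrite ?mulr0 ?mul0r//.
  by move: wv; rewrite subr_gt0 ltNge (le_trans w0 (ltW v0)).
have md := @measurable_gamma_density.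
rewrite (@ge0_integral_affine _ w 0) //; last 2 first.
- apply/measurable_EFinP; apply: measurable_funM => //.
  by apply: measurableT_comp => //; exact: measurable_funB.
- by move=> v; rewrite lee_fin mulr_ge0 ?gamma_density_ge0.
rewrite -ge0_integralZl//; last 3 first.
- apply/measurable_EFinP.
  have mw : measurable_fun setT (fun x : R => w * x + 0).
    by apply: measurable_funD => //; exact: measurable_funM.
  apply: measurable_funM; last exact: measurableT_comp.
  by apply: measurableT_comp => //; exact: measurable_funB.
- by move=> v _; rewrite lee_fin mulr_ge0 ?gamma_density_ge0.
- by rewrite lee_fin ltW.
rewrite muleC -ge0_integralZl//; last 3 first.
- by apply/measurable_EFinP; exact: measurable_beta_kernel.
- by move=> v _; rewrite lee_fin.
- by rewrite lee_fin gamma_density_ge0// mulr_ge0.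
by apply: eq_integral => t _; rewrite -!EFinM addr0 gamma_density_convolution_scaled.
Qed.

End gamma_density.

Section gamma_law.
Context {R : realType} {d : measure_display} {T : measurableType d}.
Variable P : probability T R.
Local Notation mu := (@lebesgue_measure R).

(* [R] and [measurableTypeR R] carry distinct measurable structures: [V'] is [V]
   seen as a map to the latter, on which the Lebesgue measure lives. *)
Lemma ge0_integral_density_RV (V : T -> R) (f : R -> R) (g : R -> \bar R) :
  measurable_fun setT V -> (forall x, 0 <= f x) -> measurable_fun setT f ->
  (forall A, measurable A -> P (V @^-1` A) = (\int[mu]_(x in A) (f x)%:E)%E) ->
  measurable_fun setT g -> (forall x, 0 <= g x)%E ->
  (\int[P]_w g (V w) = \int[mu]_x (g x * (f x)%:E))%E.
Proof.
move=> mV f0 mf Vlaw mg g0.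
pose V' : {mfun T >-> measurableTypeR R} := HB.pack (V : T -> measurableTypeR R)
  (isMeasurableFun.Build _ _ T (measurableTypeR R) V mV).
rewrite -(@ge0_integral_density _ _ _ mu (distribution P V'))//.
by rewrite ge0_integral_distribution.
Qed.

Definition gamma_law (X : T -> R) (s r : R) := exists2 c : R, 0 <= c &
  forall A, measurable A ->
    P (X @^-1` A) = (\int[mu]_(x in A) (gamma_density c s r x)%:E)%E.

(** Conditioning on [V], shifting the variable of [U] by the value of [V] and exchanging the
    integrals exhibits the convolution of the densities as density of the sum. *)
Lemma gamma_lawD (U V : T -> R) s1 s2 r :
  measurable_fun setT U -> measurable_fun setT V ->
  independent_pair P U V ->
  gamma_law U s1 r -> gamma_law V s2 r -> gamma_law (U \+ V) (s1 + s2) r.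
Proof.
move=> mU mV indUV [c1 c10 Ulaw] [c2 c20 Vlaw].
have [K K0 convE] := gamma_density_convolution s1 s2 r c10 c20.
have md := @measurable_gamma_density R.
pose h w := gamma_density (c1 * c2) (s1 + s2) r w.
have h0 w : 0 <= h w by rewrite gamma_density_ge0// mulr_ge0.
have lawK A : measurable A ->
    P ((U \+ V) @^-1` A) = (K * \int[mu]_(x in A) (h x)%:E)%E.
  move=> mA.
  pose C := [set yx : R * R | A (yx.2 + yx.1)].
  have mC : measurable C.
    have mD : measurable_fun setT (fun yx : R * R => yx.2 + yx.1).
      exact: measurable_funD.
    by rewrite -[C]setTI; exact: mD.
  rewrite (_ : _ @^-1` A = [set w | C (V w, U w)])//.
  rewrite independent_pair_prob//.
  rewrite (@ge0_integral_density_RV V _ (fun y => P (U @^-1` [set x | C (y, x)]))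
    mV (fun x => gamma_density_ge0 s2 r x c20) _ Vlaw)//; last first.
    exact: measurable_prob_section.
  (* The joint density of [V] and [U + V], restricted to [U + V] in [A]. *)
  pose F (z : R * R) : \bar R :=
    (\1_A z.2 * (gamma_density c1 s1 r (z.2 - z.1) * gamma_density c2 s2 r z.1))%:E.
  have F0 z : (0 <= F z)%E by rewrite lee_fin !mulr_ge0 ?gamma_density_ge0.
  have mF : measurable_fun setT F.
    apply/measurable_EFinP; apply: measurable_funM.
      by apply: (measurableT_comp (measurable_indic _)).
    apply: measurable_funM; last exact: measurableT_comp.
    by apply: measurableT_comp => //; exact: measurable_funB.
  transitivity (\int[mu]_y \int[mu]_w F (y, w))%E.
    apply: eq_integral => y _.
    have mCy : measurable [set x | C (y, x)].
      rewrite (_ : [set _ | _] = xsection C y); first exact: measurable_xsection.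
      by apply/seteqP; split => x /=; rewrite /xsection/= inE.
    rewrite Ulaw// integral_mkcond muleC -ge0_integralZl//; last 3 first.
    - apply/(measurable_restrictT _ mCy)/measurable_EFinP/measurable_funTS => //.
    - move=> x _; rewrite patchE; case: ifP => // _.
      by rewrite lee_fin gamma_density_ge0.
    - by rewrite lee_fin gamma_density_ge0.
    rewrite [RHS](@ge0_integral_affine _ 1 y)//; last first.
      by apply: measurableT_comp => //.
    rewrite mul1e; apply: eq_integral => x _.
    rewrite /F/= mul1r addrK patchE indicE.
    rewrite (_ : (x \in _) = (x + y \in A)); last by apply/idP/idP; rewrite !inE.
    by case: ifP => _; rewrite ?mul1r ?mul0r ?mule0// -EFinM mulrC.
  rewrite fubini_tonelli//.
  transitivity (\int[mu]_w (K * ((h w)%:E * (\1_A w)%:E)))%E.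
    apply: eq_integral => w _; rewrite /F/=.
    under eq_integral do rewrite EFinM.
    rewrite ge0_integralZl//; last 2 first.
    - apply/measurable_EFinP; apply: measurable_funM; last exact: md.
      by apply: (measurableT_comp (md _ _ _)); exact: measurable_funB.
    - by move=> v _; rewrite lee_fin mulr_ge0 ?gamma_density_ge0.
    by rewrite convE muleCA [in LHS](muleC (\1_A w)%:E).
  rewrite ge0_integralZl//; last 2 first.
  - apply: emeasurable_funM; apply/measurable_EFinP; first exact: md.
    exact: measurable_indic.
  - by move=> w _; rewrite mule_ge0 ?lee_fin.
  congr (_ * _)%E; rewrite [RHS]integral_mkcond; apply: eq_integral => w _.
  by rewrite patchE indicE; case: ifP => _; rewrite ?mule1 ?mule0.
(* The total mass forces [K] to be finite. *)
have KT := lawK _ measurableT.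
rewrite preimage_setT probability_setT in KT.
have [Kfin|Koo] := boolP (K \is a fin_num); last first.
  move: Koo KT; rewrite ge0_fin_numE// -leNgt leye_eq => /eqP ->.
  have : (0 <= \int[mu]_x (h x)%:E)%E by apply: integral_ge0 => x _; rewrite lee_fin.
  rewrite le_eqVlt => /orP[/eqP <-|I0]; last by rewrite gt0_mulye.
  by rewrite mule0 => /eqP; rewrite eqe oner_eq0.
exists (fine K * (c1 * c2)); first by rewrite !mulr_ge0// fine_ge0.
move=> A mA; rewrite lawK// -(fineK Kfin) -ge0_integralZl//; last 3 first.
- by apply/measurable_EFinP/measurable_funTS; exact: md.
- by move=> x _; rewrite lee_fin.
- by rewrite lee_fin fine_ge0.
apply: eq_integral => x _; rewrite -EFinM /h /gamma_density; congr EFin.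
by case: ifP => _; rewrite ?mulr0// !mulrA.
Qed.

End gamma_law.

Section gamma_law_sum.
Context {R : realType} {d : measure_display} {T : measurableType d}.
Variables (P : probability T R) (I : finType) (X : I -> {RV P >-> R}).
Hypothesis indX : mutually_independent X.

Lemma gamma_law_sum (J : eqType) (f : J -> I) (s : seq J) m r :
  injective f -> uniq s -> (0 < size s)%N -> (forall j, gamma_law P (X (f j)) m r) ->
  gamma_law P (fun w => \sum_(j <- s) X (f j) w) ((size s)%:R * m) r.
Proof.
move=> injf + + lawX; elim: s => // j s IHs /= /andP[js us] _.
(* The induction starts from one summand, an empty sum having no density. *)
case: (posnP (size s)) => [/size0nil ->|s0].
  rewrite mul1r; under eq_fun do rewrite big_seq1; exact: lawX.
rewrite (_ : (fun w => _) = X (f j) \+ (fun w => \sum_(j <- s) X (f j) w)); last first.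
  by apply/funext => w; rewrite big_cons.
rewrite -natr1 addrC mulrDl mul1r.
pose S := [set i | i \in [seq f k | k <- s]]%SET.
have mX : cylinder_measurable_fun X [set f j]%SET (X (f j)).
  by move=> B mB; apply: sigma_cylinder_preimage => //; rewrite inE.
have mS : cylinder_measurable_fun X S (fun w => \sum_(j <- s) X (f j) w).
  (* Reindexing by the subtype of elements of [s] makes every index of the sum a member of [S]. *)
  rewrite (_ : (fun w => _) =
      (fun w => \sum_(k <- seq_sub_enum s) X (f (ssval k)) w)); last first.
    by apply/funext => w; rewrite -[in LHS](val_seq_sub_enum us) big_map.
  apply: (@cylinder_measurable_sum _ _ _ _ _ _ (seq_sub s) _
    (fun k => f (ssval k))) => k.
  by rewrite inE map_f// ssvalP.
apply: gamma_lawD; [exact: measurable_funPT| |  |exact: lawX|exact: IHs].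
  exact: cylinder_measurable_fun_measurable mS.
apply: (indep_cylinder_fun indX _ mX mS) => i; rewrite !inE => /eqP ->.
by rewrite mem_map.
Qed.

End gamma_law_sum.

(** * Gamma laws of positive integer shape *)

Section erlang_law.
Context {R : realType} {d : measure_display} {T : measurableType d}.
Variable P : probability T R.
Local Notation mu := (@lebesgue_measure R).
Implicit Types (X : T -> R) (n : nat) (r : R).

(** Indexed by the shape minus one, like [exp_tail]. *)
Definition erlang_density n r := gamma_density (r ^+ n.+1 / n`!%:R) n.+1%:R r.

Definition erlang_law X n r := forall A, measurable A ->
  P (X @^-1` A) = (\int[mu]_(x in A) (erlang_density n r x)%:E)%E.

Lemma erlang_densityE n r x : 0 < x ->
  erlang_density n r x = r ^+ n.+1 / n`!%:R * (x ^+ n * expR (- (r * x))).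
Proof.
move=> x0; rewrite /erlang_density /gamma_density x0 -natr1 addrK.
by rewrite powR_mulrn ?ltW// mulrA.
Qed.

Lemma integral_gamma_density_tail c n r z : 0 <= c -> 0 < r -> 0 <= z ->
  (\int[mu]_(x in `[z, +oo[) (gamma_density c n.+1%:R r x)%:E =
   (c * (n`!%:R / r ^+ n.+1 * exp_tail n (r * z)))%:E)%E.
Proof.
move=> c0 r0 z0.
have mg : measurable_fun setT (fun x : R => (x ^+ n * expR (- (r * x)))%:E).
  by apply/measurable_EFinP; exact: measurable_exprn_expR.
transitivity (\int[mu]_(x in `[z, +oo[) (c%:E * (x ^+ n * expR (- (r * x)))%:E))%E.
  (* The two integrands are compared on the open half-line: at [x = 0] with [n = 0] they differ,
     [gamma_density] being 0 there. *)
  rewrite -!(@integral_itv_obnd_cbnd _ _ (BInfty _ false)).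
  - apply: eq_integral => x; rewrite inE/= in_itv/= andbT => zx.
    have x0 := le_lt_trans z0 zx.
    by rewrite /gamma_density x0 -natr1 addrK powR_mulrn ?(ltW x0)// -EFinM mulrA.
  - by apply: measurable_funTS; exact: measurable_funeM.
  - by apply/measurable_EFinP/measurable_funTS; exact: measurable_gamma_density.
rewrite ge0_integralZl//.
- by rewrite integral_exp_tail// EFinM.
- exact: measurable_funTS.
- move=> x; rewrite /= in_itv/= andbT => zx; rewrite lee_fin mulr_ge0 ?expR_ge0//.
  by rewrite exprn_ge0// (le_trans z0).
Qed.

(** Total mass 1 reads [c * n! / r ^ (n + 1) = 1] because [exp_tail n 0 = 1], which determines
    [c]. *)
Lemma gamma_law_erlang X n r : 0 < r -> gamma_law P X n.+1%:R r -> erlang_law X n r.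
Proof.
move=> r0 [c c0 lawX].
have mden c' : measurable_fun setT (EFin \o gamma_density c' n.+1%:R r).
  by apply/measurable_EFinP; exact: measurable_gamma_density.
have := lawX _ measurableT; rewrite preimage_setT probability_setT.
rewrite -[X in (\int[_]_(x in X) _)%E](setUv `[0, +oo[%classic).
rewrite ge0_integral_setU//=; last 4 first.
- exact: measurableC.
- by rewrite setUv; exact: mden.
- by move=> x _; rewrite lee_fin gamma_density_ge0.
- exact/disj_setPCl.
rewrite [X in (_ + X)%E]integral0_eq ?adde0; last first.
  move=> x /=; rewrite in_itv/= andbT => /negP; rewrite -ltNge => x0.
  by rewrite /gamma_density ltNge ltW.
rewrite integral_gamma_density_tail// mulr0 exp_tail_at0 mulr1 => -[cE].
suff cE' : r ^+ n.+1 / n`!%:R = c by rewrite /erlang_law /erlang_density cE'.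
have /= := congr1 ( *%R (r ^+ n.+1 / n`!%:R)) cE; rewrite mulr1 => ->; field.
by rewrite expf_neq0 ?gt_eqF//= pnatr_eq0 -lt0n fact_gt0.
Qed.

Variables (X : T -> R) (n : nat) (r : R).
Hypotheses (mX : measurable_fun setT X) (r0 : 0 < r) (lawX : erlang_law X n r).

Let c0 : 0 <= r ^+ n.+1 / n`!%:R.
Proof. by rewrite divr_ge0// exprn_ge0// ltW. Qed.

Lemma erlang_law_ge z : 0 <= z -> P [set w | z <= X w] = (exp_tail n (r * z))%:E.
Proof.
move=> z0; rewrite (_ : [set w | _] = X @^-1` `[z, +oo[); last first.
  by apply/seteqP; split => w /=; rewrite in_itv/= andbT.
rewrite lawX// integral_gamma_density_tail//; congr EFin.
rewrite mulrA (_ : _ / _ * _ = 1) ?mul1r//; field.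
by rewrite expf_neq0 ?gt_eqF//= pnatr_eq0 -lt0n fact_gt0.
Qed.

Lemma erlang_law_lt z : 0 <= z -> P [set w | X w < z] = (1 - exp_tail n (r * z))%:E.
Proof.
move=> z0; rewrite (_ : [set w | _] = ~` [set w | z <= X w]); last first.
  by apply/seteqP; split => w /=; rewrite ltNge => /negP.
rewrite probability_setC ?erlang_law_ge//.
by rewrite -[X in measurable X]setTI; apply: measurable_fun_le.
Qed.

Lemma erlang_law_le0 : P [set w | X w <= 0] = 0%E.
Proof.
rewrite (_ : [set w | _] = X @^-1` `]-oo, 0]); last first.
  by apply/seteqP; split => w /=; rewrite in_itv.
rewrite lawX// integral0_eq// => x /=; rewrite in_itv/= => x0.
by rewrite /erlang_density /gamma_density ltNge x0.
Qed.

Lemma erlang_law_atomless z : P (X @^-1` [set z]) = 0%E.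
Proof. by rewrite lawX// integral_set1. Qed.

End erlang_law.

(** * The selected antenna *)

Section total_gains.
Context {R : realType} (s : noma_system R) {d : measure_display} {T : measurableType d}.
Variable P : probability T R.
Variable h : forall U : user, 'I_(L_S s) -> 'I_(L_ s U) -> {RV P >-> R}.
Arguments h : clear implicits.
Hypotheses (gamma_h : gains_gamma h) (indep_h : gains_independent h).

Local Notation link := {U : user & ('I_(L_S s) * 'I_(L_ s U))%type}.
Let X (k : link) : {RV P >-> R} := h (tag k) (tagged k).1 (tagged k).2.
Let indX : mutually_independent X. Proof. exact: indep_h. Qed.

Local Notation rate U := (m_ s U / lambda s U).

Definition links_from (U : user) (i : 'I_(L_S s)) : {set link} :=
  [set k | (tag k == U) && ((tagged k).1 == i)]%SET.
Definition links_to (U : user) : {set link} := [set k | tag k == U]%SET.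

Lemma total_gain_measurable_from U i :
  cylinder_measurable_fun X (links_from U i) (total_gain h U i).
Proof.
have := @cylinder_measurable_sum _ _ _ P _ X _ (links_from U i)
  (fun j : 'I_(L_ s U) => Tagged (fun U => ('I_(L_S s) * 'I_(L_ s U))%type) (i, j))
  (index_enum _).
by apply => j; rewrite inE /= !eqxx.
Qed.

Lemma links_fromS U i : {subset links_from U i <= links_to U}.
Proof. by move=> k; rewrite !inE => /andP[]. Qed.

Lemma links_to_disjoint U V k : U != V -> k \in links_to U -> k \notin links_to V.
Proof. by rewrite !inE => UV /eqP ->. Qed.

Lemma links_from_disjoint U i j k : i != j ->
  k \in links_from U i -> k \notin links_from U j.
Proof. by rewrite !inE => ij /andP[_ /eqP ->]; rewrite (negbTE ij) andbF. Qed.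

Lemma total_gain_measurable_to U i :
  cylinder_measurable_fun X (links_to U) (total_gain h U i).
Proof.
move=> B mB; apply: (sigma_cylinderS (@links_fromS U i)).
exact: total_gain_measurable_from.
Qed.

Lemma measurable_total_gain U i : measurable_fun setT (total_gain h U i).
Proof. exact: cylinder_measurable_fun_measurable (@total_gain_measurable_to U i). Qed.

Lemma total_gain_erlang U i : erlang_law P (total_gain h U i) (a_ s U).-1 (rate U).
Proof.
apply: gamma_law_erlang; first exact: rate_gt0.
rewrite prednK ?a_gt0// a_def mulrC.
have := @gamma_law_sum _ _ _ P _ X indX _
  (fun j : 'I_(L_ s U) => Tagged (fun U => ('I_(L_S s) * 'I_(L_ s U))%type) (i, j))
  (index_enum _) (m_ s U) (rate U).
rewrite [size _](_ : _ = L_ s U); last by rewrite /index_enum -enumT size_enum_ord.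
apply.
- by move=> j k /= /eqP; rewrite eq_Tagged/= => /eqP[].
- exact: index_enum_uniq.
- exact: L_gt0.
(* The constant of [gamma_pdf], of which only the sign has to be checked. *)
move=> j; exists (rate U `^ m_ s U / Gamma (m_ s U)).
  rewrite divr_ge0 ?powR_ge0//; apply: Rintegral_ge0 => t _.
  by rewrite mulr_ge0 ?powR_ge0 ?expR_ge0.
by move=> A mA; exact: gamma_h.
Qed.

(** Given the gain of antenna [j], a tie confines the independent gain of antenna [i] to a single
    point, which is null for a law with a density. *)
Lemma total_gain_tie U i j : i != j ->
  P [set w | total_gain h U i w = total_gain h U j w] = 0%E.
Proof.
move=> ij; pose C := [set yx : R * R | yx.2 = yx.1].
have mC : measurable C.
  rewrite (_ : C = [set yx | yx.2 == yx.1]); last by apply/seteqP; split => ? /eqP.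
  rewrite -[X in measurable X]setTI.
  by apply: (@measurable_fun_eqr _ _ _ setT snd fst).
rewrite (_ : [set _ | _] = [set w | C (total_gain h U j w, total_gain h U i w)])//.
rewrite independent_pair_prob//; [|exact: measurable_total_gain..|].
  by apply: integral0_eq => w _; exact: (erlang_law_atomless (total_gain_erlang U i)).
apply: (indep_cylinder_fun indX); [|exact: total_gain_measurable_from..].
by move=> k; exact: links_from_disjoint.
Qed.

(** Antennas are adjoined one at a time. The induction also records that the event built so far lies
    in the sigma-algebra of its own links, which makes the next antenna independent of it. *)
Lemma max_total_gain_lt U (x : R) : 0 <= x ->
  P (\bigcap_i [set w | total_gain h U i w < x]) =
  ((1 - exp_tail (a_ s U).-1 (rate U * x)) ^+ L_S s)%:E.
Proof.
move=> x0.
have mlt i : <<s cylinder X (links_from U i) >> [set w | total_gain h U i w < x].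
  have := @total_gain_measurable_from U i `]-oo, x[%classic (measurable_itv _).
  by rewrite (_ : _ @^-1` _ = [set w | total_gain h U i w < x]).
pose links (r : seq 'I_(L_S s)) : {set link} :=
  [set k | (tag k == U) && ((tagged k).1 \in r)]%SET.
have prodE (r : seq 'I_(L_S s)) : uniq r ->
  <<s cylinder X (links r) >>
    (\bigcap_(i in [set` r]) [set w | total_gain h U i w < x]) /\
  P (\bigcap_(i in [set` r]) [set w | total_gain h U i w < x]) =
  ((1 - exp_tail (a_ s U).-1 (rate U * x)) ^+ size r)%:E.
  elim: r => [_|i r IHr /= /andP[ir ur]].
    rewrite set_nil bigcap_set0 probability_setT; split=> //.
    by apply: sub_sigma_algebra; exact: cylinderT.
  have [cr Pr] := IHr ur.
  have -> : [set` i :: r] = i |` [set` r].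
    apply/seteqP; split => k /=; first by rewrite inE => /predU1P.
    by rewrite inE => ?; apply/predU1P.
  rewrite bigcap_setU1; split.
    apply: (@measurableI _ (g_sigma_algebraType (cylinder X (links (i :: r))))).
      apply: sigma_cylinderS (mlt i) => k; rewrite !inE => /andP[-> /eqP ->].
      by rewrite eqxx.
    apply: sigma_cylinderS cr => k; rewrite !inE => /andP[-> ->].
    by rewrite orbT.
  rewrite (indep_sigma_cylinder indX _ (mlt i) cr).
    have mY := measurable_total_gain U i.
    rewrite Pr (erlang_law_lt mY (rate_gt0 s U) (total_gain_erlang U i))//.
    by rewrite exprS EFinM.
  by move=> k; rewrite !inE => /andP[_ /eqP ->]; rewrite (negbTE ir) andbF.
have [_] := prodE _ (enum_uniq 'I_(L_S s)).
rewrite size_enum_ord => <-; congr (P _).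
by apply/seteqP; split => w wx i _; apply: wx => //=; rewrite mem_enum.
Qed.

End total_gains.

Section finite_selection.
Context {R : realType} {d : measure_display} {T : measurableType d}.
Variables (P : probability T R) (I : finType) (sel : T -> I).
Hypothesis msel : forall i, measurable (sel @^-1` [set i]).

Lemma prob_ae_eq A B : measurable A -> measurable B ->
  {ae P, forall w, A w <-> B w} -> P A = P B.
Proof.
move=> mA mB [N [mN N0 AB]].
have le C D : measurable C -> measurable D -> C `<=` D `|` N -> (P C <= P D)%E.
  move=> mC mD CD; rewrite -[leRHS]adde0 -N0.
  apply: (le_trans _ (measureU2 _ mD mN)).
  by apply: le_measure; rewrite ?inE//; exact: measurableU.
apply/le_anti/andP; split; apply: le => // w Cw; have [Nw|nN] := pselect (N w);
  by [right|left; apply: contrapT => nD; apply/nN/AB => /= -[]; tauto].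
Qed.

Lemma measurable_sublevel (f : T -> R) x : measurable_fun setT f ->
  measurable [set w | f w < x].
Proof.
move=> mf; have := mf measurableT `]-oo, x[%classic (measurable_itv _).
by rewrite setTI (_ : _ @^-1` _ = [set w | f w < x]).
Qed.

Lemma measurable_superlevel (f : T -> R) x : measurable_fun setT f ->
  measurable [set w | x <= f w].
Proof.
move=> mf; rewrite (_ : [set w | _] = ~` [set w | f w < x]).
  by apply: measurableC; exact: measurable_sublevel.
by apply/seteqP; split => w /=; rewrite leNgt => /negP.
Qed.

Lemma prob_selection A : measurable A ->
  P A = (\sum_(i \in [set: I]) P (sel @^-1` [set i] `&` A))%E.
Proof.
have finI : finite_set [set: I] by exact: finite_finset.
move=> mA; rewrite -measure_fin_bigcup//.
- congr (P _); apply/seteqP; split => [w Aw|w [i _ []]//].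
  by exists (sel w).
- by move=> i j _ _ [w [[/= <- _] [/= <- _]]].
- by move=> i _; exact: measurableI.
Qed.

Lemma measurable_selection (f : I -> T -> R) :
  (forall i, measurable_fun setT (f i)) -> measurable_fun setT (fun w => f (sel w) w).
Proof.
move=> mf _ B mB; rewrite setTI.
rewrite (_ : _ @^-1` _ = \bigcup_(i in [set: I]) (sel @^-1` [set i] `&` f i @^-1` B)).
  apply: fin_bigcup_measurable => [|i _]; first exact: finite_finset.
  apply: measurableI => //.
  by rewrite -[X in measurable X]setTI; exact: mf.
by apply/seteqP; split => [w Bw|w [i _ [/= <-]]//]; exists (sel w).
Qed.

End finite_selection.

Section best_antenna.
Context {R : realType} (s : noma_system R) {d : measure_display} {T : measurableType d}.
Variable P : probability T R.
Variable h : forall U : user, 'I_(L_S s) -> 'I_(L_ s U) -> {RV P >-> R}.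
Arguments h : clear implicits.
Variable ihat : T -> 'I_(L_S s).
Hypotheses (gamma_h : gains_gamma h) (indep_h : gains_independent h).
Hypothesis best : solution_I h ihat.

Local Notation link := {U : user & ('I_(L_S s) * 'I_(L_ s U))%type}.
Let X (k : link) : {RV P >-> R} := h (tag k) (tagged k).1 (tagged k).2.
Let indX : mutually_independent X. Proof. exact: indep_h. Qed.
Let mihat i : measurable (ihat @^-1` [set i]). Proof. exact: best.1. Qed.

Definition sel_gain U w := total_gain h U (ihat w) w.

Lemma measurable_sel_gain U : measurable_fun setT (sel_gain U).
Proof.
by apply: measurable_selection => // i; exact: measurable_total_gain.
Qed.

Lemma ae_no_tie : {ae P, forall w, forall i j, i != j ->
  total_gain h Near i w != total_gain h Near j w}.
Proof.
apply: filter_forall => i; apply: filter_forall => j.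
have [<-|ij] := eqVneq i j; first by apply: aeW => w.
pose tie := [set w | total_gain h Near i w = total_gain h Near j w].
suff : P.-negligible tie.
  by apply: negligibleS => w /= h1; apply: contrapT => /eqP nt; apply: h1.
apply/negligibleP; last exact: total_gain_tie.
rewrite (_ : tie = [set w | total_gain h Near i w == total_gain h Near j w]); last first.
  by apply/seteqP; split => w /eqP.
rewrite -[X in measurable X]setTI.
by apply: measurable_fun_eqr => //; exact: measurable_total_gain.
Qed.

Lemma ae_total_gain_gt0 : {ae P, forall w, forall U i, 0 < total_gain h U i w}.
Proof.
apply: filter_forall => U; apply: filter_forall => i.
suff : P.-negligible [set w | total_gain h U i w <= 0].
  by apply: negligibleS => w /= /negP; rewrite -leNgt.
apply/negligibleP.
  rewrite -[X in measurable X]setTI.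
  by apply: measurable_fun_ler => //; exact: measurable_total_gain.
exact: (erlang_law_le0 (total_gain_erlang gamma_h indep_h U i)).
Qed.

(** The probability is summed over the selected antenna: [ihat = i] with [Y_i] in [A] is almost
    surely an event of the near links, independent of [Z_i], whose law is the same for all [i], so
    that its factor leaves the sum. With this law written out, [A = setT] gives the law of [Z_ihat],
    and independence follows. *)
Lemma sel_gain_joint A B : measurable A -> measurable B ->
  P (sel_gain Near @^-1` A `&` sel_gain Eve @^-1` B) =
  (P (sel_gain Near @^-1` A) * \int[lebesgue_measure]_(x in B)
    (erlang_density (a_ s Eve).-1 (m_ s Eve / lambda s Eve) x)%:E)%E.
Proof.
move=> mA mB.
have mpre U C : measurable C -> measurable (sel_gain U @^-1` C).
  by move=> mC; rewrite -[X in measurable X]setTI; exact: measurable_sel_gain.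
have mtot U i C : measurable C -> measurable (total_gain h U i @^-1` C).
  by move=> mC; rewrite -[X in measurable X]setTI; exact: measurable_total_gain.
(* Off the null set of ties, [ihat = i] is the event [E i] on the near gains. *)
pose E i := \bigcap_(j in [set j | j != i])
  [set w | total_gain h Near j w < total_gain h Near i w].
pose sigmaN := g_sigma_algebraType (cylinder X (links_to s Near)).
have cE i : <<s cylinder X (links_to s Near) >> (E i).
  apply: (@fin_bigcap_measurable _ sigmaN) => [|j _]; first exact: finite_finset.
  have mc k : measurable_fun setT (total_gain h Near k : sigmaN -> R).
    by apply/cylinder_measurable_funP; exact: total_gain_measurable_to.
  rewrite -[X in measurable X]setTI.
  exact: (measurable_fun_ltr (mc j) (mc i)).
have mE i : measurable (E i) by exact: sigma_cylinder_measurable (cE i).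
have aeE i : {ae P, forall w, ihat w = i <-> E i w}.
  apply: filterS ae_no_tie => w tie; split=> [<- j /= ji|Ei].
    by rewrite lt_neqAle tie// best.2.
  apply: contrapT => /eqP hi; have := Ei _ hi; rewrite /= ltNge.
  by rewrite best.2.
have step i :
  P (ihat @^-1` [set i] `&` (sel_gain Near @^-1` A `&` sel_gain Eve @^-1` B)) =
  (P (ihat @^-1` [set i] `&` sel_gain Near @^-1` A) * \int[lebesgue_measure]_(x in B)
    (erlang_density (a_ s Eve).-1 (m_ s Eve / lambda s Eve) x)%:E)%E.
  (* Here and on the other side, the random antenna is replaced by the fixed [i], which brings the
     near part into [sigmaN]. *)
  rewrite (@prob_ae_eq _ _ _ P _
    (E i `&` total_gain h Near i @^-1` A `&` total_gain h Eve i @^-1` B)); last 3 first.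
  - by apply: measurableI => //; apply: measurableI; exact: mpre.
  - by apply: measurableI; [apply: measurableI => //|]; exact: mtot.
  - apply: filterS (aeE i) => w [ie ei]; rewrite /sel_gain/=; split.
      by case=> /= hi [? ?]; subst i; split=> //; split=> //; exact: ie.
    by case=> -[/ei <-].
  rewrite (@prob_ae_eq _ _ _ P (ihat @^-1` [set i] `&` _)
    (E i `&` total_gain h Near i @^-1` A)); last 3 first.
  - by apply: measurableI => //; exact: mpre.
  - by apply: measurableI => //; exact: mtot.
  - apply: filterS (aeE i) => w [ie ei]; rewrite /sel_gain/=; split.
      by case=> /= hi ?; subst i; split=> //; exact: ie.
    by case=> /ei <-.
  rewrite -(total_gain_erlang gamma_h indep_h Eve i mB).
  apply: (@indep_sigma_cylinder _ _ _ P _ X indX (links_to s Near) (links_to s Eve)).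
  - by move=> k; apply: links_to_disjoint; apply/eqP.
  - apply: (@measurableI _ sigmaN); first exact: cE.
    exact: total_gain_measurable_to.
  - exact: total_gain_measurable_to.
rewrite (prob_selection P mihat); last by apply: measurableI; exact: mpre.
rewrite [in RHS](prob_selection P mihat); last exact: mpre.
by rewrite ge0_mule_fsuml//; apply: eq_fsbigr => i _; exact: step.
Qed.

Lemma sel_gain_Eve_law :
  erlang_law P (sel_gain Eve) (a_ s Eve).-1 (m_ s Eve / lambda s Eve).
Proof.
move=> B mB; have := sel_gain_joint measurableT mB.
by rewrite preimage_setT setTI probability_setT mul1e.
Qed.

Lemma sel_gain_indep : independent_pair P (sel_gain Near) (sel_gain Eve).
Proof. by move=> A B mA mB; rewrite sel_gain_joint// sel_gain_Eve_law. Qed.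

Lemma sel_gain_Near_lt x : 0 <= x -> P [set w | sel_gain Near w < x] =
  ((1 - exp_tail (a_ s Near).-1 (m_ s Near / lambda s Near * x)) ^+ L_S s)%:E.
Proof.
move=> x0; rewrite -(max_total_gain_lt gamma_h indep_h Near x0); congr (P _).
apply/seteqP; split => w /=; last exact.
by move=> lt i _ /=; apply: le_lt_trans lt; exact: best.2.
Qed.

End best_antenna.

(** * Outage events *)

Section integral_is.
Context {R : realType}.
Local Notation mu := (@lebesgue_measure R).
Variable D : set (measurableTypeR R).
Hypothesis mD : measurable D.
Implicit Types (f g : R -> R) (u v : R).

(** The coefficients [Phi_N] have varying signs, so termwise integration needs integrability, which
    is carried along with the value. *)
Definition integral_is f v :=
  mu.-integrable D (EFin \o f) /\ (\int[mu]_(x in D) (f x)%:E = v%:E)%E.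

Lemma integral_isD f g u v : integral_is f u -> integral_is g v ->
  integral_is (fun x => f x + g x) (u + v).
Proof.
move=> [intf fu] [intg gv]; split; first exact: (integrableD mD intf intg).
by under eq_integral do rewrite EFinD; rewrite (integralD mD intf intg) fu gv.
Qed.

Lemma integral_isZ (c : R) f u : integral_is f u ->
  integral_is (fun x => c * f x) (c * u).
Proof.
move=> [intf fu]; split; first exact: (integrableZl mD c intf).
by under eq_integral do rewrite EFinM; rewrite (integralZl mD intf) fu.
Qed.

Lemma integral_is0 : integral_is (fun=> 0) 0.
Proof. by split; [exact: integrable0|rewrite integral0]. Qed.

Lemma integral_is_sum (I : Type) (r : seq I) (Q : pred I)
    (F : I -> R -> R) (v : I -> R) :
  (forall i, Q i -> integral_is (F i) (v i)) ->
  integral_is (fun x => \sum_(i <- r | Q i) F i x) (\sum_(i <- r | Q i) v i).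
Proof.
move=> Fv; elim: r => [|i r IHr].
  by rewrite big_nil; under eq_fun do rewrite big_nil; exact: integral_is0.
rewrite big_cons (_ : (fun x => _) = fun x =>
    if Q i then F i x + \sum_(j <- r | Q j) F j x else \sum_(j <- r | Q j) F j x).
  by case: ifPn => // Qi; apply: integral_isD => //; exact: Fv.
by apply/funext => x; rewrite big_cons.
Qed.

End integral_is.

(** * The closed form of the third term *)

Section closed_forms.
Context {R : realType}.
Local Notation mu := (@lebesgue_measure R).

Lemma integral_is_exp_tail n (B z : R) : 0 < B -> 0 <= z ->
  integral_is `[z, +oo[%classic (fun x => x ^+ n * expR (- (B * x)))
    (n`!%:R / B ^+ n.+1 * exp_tail n (B * z)).
Proof.
move=> B0 z0; split; last exact: integral_exp_tail.
apply/integrableP; split.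
  by apply/measurable_EFinP/measurable_funTS; exact: measurable_exprn_expR.
rewrite (_ : integral _ _ _ =
    (\int[mu]_(x in `[z, +oo[) (x ^+ n * expR (- (B * x)))%:E)%E); last first.
  apply: eq_integral => x; rewrite inE/= in_itv/= andbT => zx; rewrite /= ger0_norm//.
  by rewrite mulr_ge0 ?expR_ge0// exprn_ge0// (le_trans z0).
by rewrite integral_exp_tail// ltry.
Qed.

Lemma Gamma_nat n : Gamma n.+1%:R = n`!%:R :> R.
Proof.
rewrite /Gamma /Rintegral.
have -> : (\int[mu]_(t in `]0%R, +oo[) (t `^ (n.+1%:R - 1) * expR (- t))%:E =
   \int[mu]_(t in `]0%R, +oo[) (t ^+ n * expR (- (1 * t)))%:E)%E.
  apply: eq_integral => t; rewrite inE/= in_itv/= andbT => t0.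
  by rewrite -natr1 addrK powR_mulrn ?ltW// mul1r.
rewrite integral_itv_obnd_cbnd; last first.
  by apply/measurable_EFinP/measurable_funTS; exact: measurable_exprn_expR.
by rewrite integral_exp_tail// mulr0 exp_tail_at0 expr1n divr1 mulr1.
Qed.

Variable s : noma_system R.
Local Notation rate U := (m_ s U / lambda s U).
Local Notation nE := (a_ s Eve).-1.

(** As [Gamma (a_E + m)] is [(a_E + m - 1)!], the sum over [n] is an expanded exponential tail: up
    to its coefficient, the integral of [z ^ (a_E - 1 + m) e ^ (- B2 z)] from [zA] on. *)
Lemma Psi_N_I_sum p (dl : {ffun 'I_(a_ s Near) -> 'I_p.+1}) m gth RsN :
  (m <= phi_N dl)%N -> 0 < B2_N_I s p RsN ->
  let zA := A_ s gth / gammaE s in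
  let u := 2 `^ RsN * gammaE s / gamma0 s in
  let g := gamma_sN s RsN / gamma0 s in
  \sum_(0 <= n < a_ s Eve + m) Psi_N_I dl m n RsN
    * (A_ s gth * B2_N_I s p RsN / gammaE s) ^+ n
    * expR (- (A_ s gth * B2_N_I s p RsN / gammaE s)) =
  'C(phi_N dl, m)%:R * (Phi_N dl * (rate Eve ^+ nE.+1 / nE`!%:R)
     * expR (- (p%:R * m_ s Near * g / lambda s Near)) * g ^+ (phi_N dl - m) * u ^+ m)
  * ((nE + m)`!%:R / B2_N_I s p RsN ^+ (nE + m).+1
     * exp_tail (nE + m) (B2_N_I s p RsN * zA)).
Proof.
move=> mphi B20 zA u g; rewrite /exp_tail.
have [k aE] : exists k, a_ s Eve = k.+1 by exists nE; rewrite prednK ?a_gt0.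
rewrite aE/= addSn big_mkord !mulr_sumr; apply: eq_bigr => -[n /= _] _.
have -> : A_ s gth * B2_N_I s p RsN / gammaE s = B2_N_I s p RsN * zA.
  by rewrite /zA; ring.
rewrite /Psi_N_I aE addSn !Gamma_nat /g /u.
rewrite (_ : p%:R * m_ s Near * gamma_sN s RsN / (gamma0 s * lambda s Near) =
  p%:R * m_ s Near * (gamma_sN s RsN / gamma0 s) / lambda s Near); last first.
  by field; rewrite lambda_neq0 gt_eqF// gamma0_gt0.
have f0 i : i`!%:R != 0 :> R by rewrite pnatr_eq0 -lt0n fact_gt0.
move: (lambda s Eve) (lambda_neq0 s Eve) => lE lE0.
move: (Phi_N dl) (expR _) (expR _) => Phi e1 e2.
have g0 : gamma0 s != 0 by rewrite gt_eqF// gamma0_gt0.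
move: (B2_N_I s p RsN) B20 => B B0.
have -> : gamma0 s ^+ phi_N dl = gamma0 s ^+ (phi_N dl - m) * gamma0 s ^+ m.
  by rewrite -exprD subnK.
have aN0 : alphaN s != 0 by rewrite gt_eqF// alphaN_gt0.
rewrite !expr_div_n; field.
by rewrite !f0 !expf_neq0//= ?gt_eqF.
Qed.

(** Expanding the power of [g + u z] produces the sum over [m]; the rates in [z] of the two
    exponentials, [p mN u / lN] and [mE / lE], add up to [B2_N_I]. *)
Lemma erlang_density_expand p (dl : {ffun 'I_(a_ s Near) -> 'I_p.+1}) RsN z :
  0 < z ->
  let u := 2 `^ RsN * gammaE s / gamma0 s in
  let g := gamma_sN s RsN / gamma0 s in
  Phi_N dl * (g + u * z) ^+ phi_N dl
    * expR (- (p%:R * m_ s Near * (g + u * z) / lambda s Near))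
    * erlang_density nE (rate Eve) z =
  \sum_(0 <= m < (phi_N dl).+1)
   'C(phi_N dl, m)%:R * (Phi_N dl * (rate Eve ^+ nE.+1 / nE`!%:R)
     * expR (- (p%:R * m_ s Near * g / lambda s Near)) * g ^+ (phi_N dl - m) * u ^+ m)
   * (z ^+ (nE + m) * expR (- (B2_N_I s p RsN * z))).
Proof.
move=> z0 u g; rewrite erlang_densityE// exprDn big_mkord.
have -> : expR (- (p%:R * m_ s Near * (g + u * z) / lambda s Near)) =
   expR (- (p%:R * m_ s Near * g / lambda s Near)) *
   expR (- (p%:R * m_ s Near * u * z / lambda s Near)).
  by rewrite -expRD; congr expR; ring.
have -> : expR (- (B2_N_I s p RsN * z)) =
    expR (- (p%:R * m_ s Near * u * z / lambda s Near)) * expR (- (rate Eve * z)).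
  rewrite -expRD; congr expR; rewrite /B2_N_I /u; field.
  by rewrite !lambda_neq0 gt_eqF// gamma0_gt0.
rewrite -[LHS]mulrA -mulrA -[LHS]mulrCA mulr_suml; apply: eq_bigr => -[m /= _] _.
rewrite [(u * z) ^+ m]exprMn exprD -mulr_natr.
move: (rate Eve ^+ nE.+1 / nE`!%:R) (expR _) (expR _) (expR _) => K e1 e2 e3.
ring.
Qed.

Lemma B2_N_I_gt0 p RsN : 0 < B2_N_I s p RsN.
Proof.
have g0 := gamma0_gt0 s; have gE := gammaE_gt0 s.
have mN := m_gt0 s Near; have lN : 0 < lambda s Near := mean_gt0 s Near.
apply: ltr_wpDl; last by rewrite divr_gt0 ?m_gt0 ?mean_gt0.
apply: divr_ge0; last by rewrite ltW// mulr_gt0.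
by apply: mulr_ge0; rewrite ?powR_ge0// mulr_ge0 ?(ltW gE)// mulr_ge0// ltW.
Qed.

Lemma Lambda_3_I_integral gth RsN : 0 < A_ s gth ->
  let zA := A_ s gth / gammaE s in
  let t z := gamma_sN s RsN / gamma0 s + 2 `^ RsN * gammaE s / gamma0 s * z in
  (\int[mu]_(z in `[zA, +oo[) ((F_Y_I s (t z) - F_Y_I s (A_ s gth / gamma0 s))
     * erlang_density nE (rate Eve) z)%:E)%E = (Lambda_3_I s gth RsN)%:E.
Proof.
move=> A0 zA t.
have zA0 : 0 < zA by rewrite divr_gt0// gammaE_gt0.
have rE0 := rate_gt0 s Eve.
set a := A_ s gth / gamma0 s.
pose coef p (dl : {ffun 'I_(a_ s Near) -> 'I_p.+1}) m :=
  'C(phi_N dl, m)%:R * (Phi_N dl * (rate Eve ^+ nE.+1 / nE`!%:R)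
     * expR (- (p%:R * m_ s Near * (gamma_sN s RsN / gamma0 s) / lambda s Near))
     * (gamma_sN s RsN / gamma0 s) ^+ (phi_N dl - m)
     * (2 `^ RsN * gammaE s / gamma0 s) ^+ m).
(* The integrand as a finite combination of functions [z ^ k e ^ (- B z)]. The leading 1 of
   [F_Y_I s (t z)] joins [- F_Y_I s a] in the first term, which integrates to [B1_N_I]. *)
pose f z := (1 - F_Y_I s a) * (rate Eve ^+ nE.+1 / nE`!%:R)
    * (z ^+ nE * expR (- (rate Eve * z)))
  + \sum_(1 <= p < (L_S s).+1)
      \sum_(dl : {ffun 'I_(a_ s Near) -> 'I_p.+1} | Delta_N dl == p)
        \sum_(0 <= m < (phi_N dl).+1)
          coef p dl m * (z ^+ (nE + m) * expR (- (B2_N_I s p RsN * z))).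
transitivity (\int[mu]_(z in `[zA, +oo[) (f z)%:E)%E.
  apply: eq_integral => z; rewrite inE/= in_itv/= andbT => zAz; congr EFin.
  have z0 : 0 < z by exact: lt_le_trans zA0 zAz.
  rewrite /f -mulrA -erlang_densityE// {1}/F_Y_I addrAC mulrDl; congr (_ + _).
  rewrite mulr_suml; apply: eq_bigr => p _; rewrite mulr_suml; apply: eq_bigr => dl _.
  exact: erlang_density_expand.
suff [_ ->] : integral_is `[zA, +oo[%classic f (Lambda_3_I s gth RsN) by [].
have B1E : B1_N_I s gth = (1 - F_Y_I s a) * (rate Eve ^+ nE.+1 / nE`!%:R) *
    (nE`!%:R / rate Eve ^+ nE.+1 * exp_tail nE (rate Eve * zA)).
  rewrite /B1_N_I F_Z_exp_tail -/zA -/a subKr; field.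
  by rewrite expf_neq0 ?gt_eqF//= pnatr_eq0 -lt0n fact_gt0.
rewrite /Lambda_3_I B1E; apply: integral_isD => //.
  by apply: integral_isZ => //; apply: integral_is_exp_tail => //; exact: ltW.
apply: integral_is_sum => // p _; apply: integral_is_sum => // dl _.
rewrite (eq_big_nat _ _ (F2 := fun m => coef p dl m * ((nE + m)`!%:R /
    B2_N_I s p RsN ^+ (nE + m).+1 * exp_tail (nE + m) (B2_N_I s p RsN * zA)))); last first.
  by move=> m /andP[_ mphi]; rewrite Psi_N_I_sum ?B2_N_I_gt0.
apply: integral_is_sum => // m _.
apply: integral_isZ => //; apply: integral_is_exp_tail => //; first exact: B2_N_I_gt0.
exact: ltW.
Qed.

End closed_forms.

(** * Outage conditions as linear bounds on the gains *)

Section thresholds.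
Context {R : realType} (s : noma_system R).
Implicit Types (g x y z gth r : R).

Let aN0 := alphaN_gt0 s.
Let aF0 : 0 < alphaF s := lt_trans (alphaN_gt0 s) (alphaN_lt_alphaF s).

Lemma log2_lt x r : 0 < x -> (log2 x < r) = (x < 2 `^ r).
Proof.
move=> x0; have ln2 : 0 < ln (2 : R) by rewrite ln_gt0// ltr1n.
rewrite /log2 ltr_pdivrMr// -ln_powR ltr_ln ?posrE ?powR_gt0//.
Qed.

Lemma gt_log2 x r : 0 < x -> (r < log2 x) = (2 `^ r < x).
Proof.
move=> x0; have ln2 : 0 < ln (2 : R) by rewrite ln_gt0// ltr1n.
rewrite /log2 ltr_pdivlMr// -ln_powR ltr_ln ?posrE ?powR_gt0//.
Qed.

Lemma gamma_th_lt_beta gth : gth < beta s -> 0 < alphaF s - alphaN s * gth.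
Proof. by rewrite /beta ltr_pdivlMr// subr_gt0 mulrC. Qed.

Lemma snr_xF_lt g y gth : 0 < g -> 0 < y -> gth < beta s ->
  (snr_xF s g y < gth) = (y < A_ s gth / g).
Proof.
move=> g0 y0 /gamma_th_lt_beta b0.
have p0 : 0 < alphaN s * g * y + 1 by rewrite ltr_wpDl// !mulr_ge0// ltW.
rewrite /snr_xF /A_ ltr_pdivrMr// !ltr_pdivlMr//.
by rewrite -subr_gt0 -[RHS]subr_gt0; congr (0 < _); ring.
Qed.

(** Interference alone would give the ratio [beta]; the noise term 1 in the denominator makes it
    strictly smaller. *)
Lemma snr_xF_lt_beta g y : 0 < g -> 0 < y -> snr_xF s g y < beta s.
Proof.
move=> g0 y0; have p0 : 0 < alphaN s * g * y + 1 by rewrite ltr_wpDl// !mulr_ge0// ltW.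
rewrite /snr_xF /beta ltr_pdivrMr// mulrDr mulr1.
rewrite (_ : _ / _ * _ = alphaF s * g * y) ?ltrDl ?divr_gt0//.
by field; rewrite gt_eqF.
Qed.

Lemma log2_snr_xN_lt y r : 0 < y ->
  (log2 (1 + snr_xN s (gamma0 s) y) < r) = (y < gamma_sN s r / gamma0 s).
Proof.
have g0 := gamma0_gt0 s; move=> y0.
rewrite /snr_xN log2_lt; last by rewrite ltr_wpDr// !mulr_ge0// ltW.
rewrite /gamma_sN !ltr_pdivlMr//.
by rewrite -subr_gt0 -[RHS]subr_gt0; congr (0 < _); ring.
Qed.

(** For [r > 0] the truncation at 0 does not affect the comparison, and clearing the denominator
    leaves an inequality linear in [y] and [z]. *)
Lemma secrecy_rate_lt y z r : 0 < y -> 0 < z -> 0 < r ->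
  (Num.max 0 (log2 ((1 + snr_xN s (gamma0 s) y) / (1 + snr_xN s (gammaE s) z))) < r) =
  (y < gamma_sN s r / gamma0 s + 2 `^ r * gammaE s / gamma0 s * z).
Proof.
have g0 := gamma0_gt0 s; have gE := gammaE_gt0 s; move=> y0 z0 r0.
have p0 : 0 < 1 + snr_xN s (gamma0 s) y by rewrite ltr_wpDr// !mulr_ge0// ltW.
have q0 : 0 < 1 + snr_xN s (gammaE s) z by rewrite ltr_wpDr// !mulr_ge0// ltW.
rewrite gt_max r0/= log2_lt ?divr_gt0// ltr_pdivrMr// /snr_xN /gamma_sN.
have -> : (2 `^ r - 1) / alphaN s / gamma0 s + 2 `^ r * gammaE s / gamma0 s * z =
  (2 `^ r * (1 + alphaN s * gammaE s * z) - 1) / (alphaN s * gamma0 s).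
  by field; rewrite !gt_eqF.
rewrite ltr_pdivlMr ?mulr_gt0//.
by rewrite -subr_gt0 -[RHS]subr_gt0; congr (0 < _); ring.
Qed.

Lemma A_gt0 gth : 0 < gth -> gth < beta s -> 0 < A_ s gth.
Proof. by move=> ? /gamma_th_lt_beta ?; rewrite divr_gt0. Qed.

(** At rate [eta] the rate threshold and the decoding threshold on the near gain coincide. *)
Lemma lt_eta gth r : gth < beta s -> (r < eta s gth) = (gamma_sN s r < A_ s gth).
Proof.
move=> /gamma_th_lt_beta b0; rewrite /eta gt_log2 ?divr_gt0// /gamma_sN /A_.
rewrite !ltr_pdivlMr// [X in _ = (X < _)]mulrAC ltr_pdivrMr//.
by rewrite -subr_gt0 -[RHS]subr_gt0; congr (0 < _); ring.
Qed.

Lemma gamma_th_gt0 (RF : R) : 0 < RF -> 0 < gamma_th RF.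
Proof.
by move=> RF0; rewrite subr_gt0 /powR pnatr_eq0/= expR_gt1 mulr_gt0// ln_gt0// ltr1n.
Qed.

End thresholds.

(** * Measurability of the ratios and rates *)

Section measurability.
Context {R : realType} {d : measure_display} {T : measurableType d}.

Lemma measurable_invr : measurable_fun setT (@GRing.inv R).
Proof.
(* The power [-1] is inversion on nonnegative reals, 0 going to 0 in both cases; oddness covers the
   negative ones. *)
rewrite (_ : @GRing.inv R = fun x => if 0 <= x then x `^ (- 1) else - ((- x) `^ (- 1))).
  apply: measurable_fun_ifT; first exact: measurable_fun_ler.
    exact: measurable_powR.
  apply: measurableT_comp => //; apply: (measurableT_comp (measurable_powR _)) => //.
apply/funext => x; have [x0|x0] := leP 0 x; first by rewrite powR_inv1.
by rewrite powR_inv1 ?oppr_ge0 ?ltW// invrN opprK.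
Qed.

Lemma measurable_funV (f : T -> R) : measurable_fun setT f ->
  measurable_fun setT (fun w => (f w)^-1).
Proof. by move=> mf; exact: (measurableT_comp measurable_invr). Qed.

Variable s : noma_system R.

Lemma measurable_snr_xF g (f : T -> R) : measurable_fun setT f ->
  measurable_fun setT (fun w => snr_xF s g (f w)).
Proof.
move=> mf; apply: measurable_funM; first exact: measurable_funM.
by apply: measurable_funV; apply: measurable_funD => //; exact: measurable_funM.
Qed.

Lemma measurable_log2 (f : T -> R) : measurable_fun setT f ->
  measurable_fun setT (fun w => log2 (f w)).
Proof. by move=> mf; apply: measurable_funM => //; exact: measurableT_comp. Qed.

End measurability.

(** * Probabilities of the outage events *)

Section outage_probabilities.
Context {R : realType} (s : noma_system R) {d : measure_display} {T : measurableType d}.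
Variable P : probability T R.
Variable h : forall U : user, 'I_(L_S s) -> 'I_(L_ s U) -> {RV P >-> R}.
Arguments h : clear implicits.
Variable ihat : T -> 'I_(L_S s).
Hypotheses (gamma_h : gains_gamma h) (indep_h : gains_independent h).
Hypothesis best : solution_I h ihat.

Local Notation Y := (sel_gain h ihat Near).
Local Notation Z := (sel_gain h ihat Eve).
Local Notation mu := (@lebesgue_measure R).
Local Notation rate U := (m_ s U / lambda s U).

Let mY : measurable_fun setT Y. Proof. exact: measurable_sel_gain. Qed.
Let mZ : measurable_fun setT Z. Proof. exact: measurable_sel_gain. Qed.

Lemma ae_sel_gain_gt0 : {ae P, forall w, 0 < Y w /\ 0 < Z w}.
Proof.
by apply: filterS (ae_total_gain_gt0 gamma_h indep_h) => w gain0; split; exact: gain0.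
Qed.

Lemma sel_gain_Near_F_Y_I x : 0 <= x -> P [set w | Y w < x] = (F_Y_I s x)%:E.
Proof. by move=> x0; rewrite sel_gain_Near_lt// F_Y_I_exp_tail. Qed.

Lemma sel_gain_Near_between x y : 0 <= x -> x <= y ->
  P [set w | x <= Y w < y] = (F_Y_I s y - F_Y_I s x)%:E.
Proof.
move=> x0 xy; rewrite EFinB -!sel_gain_Near_F_Y_I ?(le_trans x0)//.
have mlt z : measurable [set w | Y w < z] by exact: measurable_sublevel.
rewrite (_ : [set w | x <= Y w < y] = [set w | Y w < y] `\` [set w | Y w < x]); last first.
  apply/seteqP; split => w /=; first by move=> /andP[xw ->]; rewrite ltNge xw.
  by move=> [-> /negP]; rewrite -leNgt => ->.
rewrite measureD//; last by rewrite -ge0_fin_numE// fin_num_measure.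
congr (_ - P _)%E; apply/seteqP; split => w /=; first by case.
by move=> wx; split=> //; exact: lt_le_trans wx xy.
Qed.

Lemma sel_gain_Eve_F_Z x : 0 <= x -> P [set w | Z w < x] = (F_Z s x)%:E.
Proof.
have lawZ := sel_gain_Eve_law gamma_h indep_h best.
by move=> x0; rewrite F_Z_exp_tail (erlang_law_lt mZ (rate_gt0 s Eve) lawZ).
Qed.

Lemma sel_gain_between_lt x y z : 0 <= x -> x <= y -> 0 <= z ->
  P [set w | x <= Y w < y /\ Z w < z] = ((F_Y_I s y - F_Y_I s x) * F_Z s z)%:E.
Proof.
move=> x0 xy z0; rewrite EFinM -sel_gain_Near_between// -sel_gain_Eve_F_Z//.
have := sel_gain_indep gamma_h indep_h best
  (measurable_itv `[x, y[) (measurable_itv `]-oo, z[).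
rewrite (_ : Y @^-1` _ = [set w | x <= Y w < y]); last first.
  by apply/seteqP; split => w /=; rewrite in_itv.
by rewrite (_ : Z @^-1` _ = [set w | Z w < z]).
Qed.

(** Integrating out [Z] by independence leaves the probability that [Y] lies in an interval
    depending on [z]. *)
Lemma prob_Lambda_3_I gth RsN : 0 < gth -> gth < beta s -> 0 < RsN ->
  P [set w | [/\ A_ s gth / gammaE s <= Z w, A_ s gth / gamma0 s <= Y w &
    Y w < gamma_sN s RsN / gamma0 s + 2 `^ RsN * gammaE s / gamma0 s * Z w]] =
  (Lambda_3_I s gth RsN)%:E.
Proof.
move=> gth0 gthb RsN0; have A0 := A_gt0 gth0 gthb.
have g0 := gamma0_gt0 s; have gE := gammaE_gt0 s; have aN0 := alphaN_gt0 s.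
pose t z := gamma_sN s RsN / gamma0 s + 2 `^ RsN * gammaE s / gamma0 s * z.
pose a := A_ s gth / gamma0 s; pose zA := A_ s gth / gammaE s.
pose b (zy : R * R) := [&& zA <= zy.1, a <= zy.2 & zy.2 < t zy.1].
pose C := [set zy | b zy].
have mb : measurable_fun setT b.
  have mt : measurable_fun setT (fun zy : R * R => t zy.1).
    by apply: measurable_funD => //; apply: measurable_funM.
  apply: measurable_and; first exact: measurable_fun_ler.
  by apply: measurable_and; [exact: measurable_fun_ler|exact: measurable_fun_ltr].
have mC : measurable C.
  by rewrite -[C]setTI; apply: (mb measurableT [set true]).
rewrite (_ : [set w | _] = [set w | C (Z w, Y w)]); last first.
  by apply/seteqP; split => w /and3P.
rewrite independent_pair_prob//; last exact: sel_gain_indep.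
rewrite (@ge0_integral_density_RV _ _ _ P Z (erlang_density (a_ s Eve).-1 (rate Eve))
  (fun z => P (Y @^-1` [set y | C (z, y)])))//; last 4 first.
- by move=> x; apply: gamma_density_ge0; rewrite divr_ge0// exprn_ge0// ltW// rate_gt0.
- exact: measurable_gamma_density.
- exact: sel_gain_Eve_law.
- exact: measurable_prob_section.
rewrite -Lambda_3_I_integral// [RHS]integral_mkcond; apply: eq_integral => z _.
rewrite patchE (_ : (z \in _) = (zA <= z)); last first.
  by apply/idP/idP; rewrite inE/= in_itv/= andbT.
case: ifPn => zAz.
  have z0 : 0 < z by apply: lt_le_trans zAz; rewrite divr_gt0.
  (* From [z * gammaE >= A_] and [2 ^ RsN > 1]; hence the probability at [z] is a difference of
     values of [F_Y_I], however [RsN] compares with [eta]. *)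
  have a_le_t : a <= t z.
    have R1 : 0 < 2 `^ RsN - 1 := gamma_th_gt0 RsN0.
    have -> : t z = (gamma_sN s RsN + 2 `^ RsN * (z * gammaE s)) / gamma0 s.
      by rewrite /t; field; rewrite gt_eqF.
    rewrite ler_pM2r ?invr_gt0//; rewrite ler_pdivrMr// in zAz.
    apply: le_trans zAz _; rewrite -subr_ge0.
    rewrite (_ : _ - _ = gamma_sN s RsN + (2 `^ RsN - 1) * (z * gammaE s)).
      by rewrite addr_ge0// ?divr_ge0 ?mulr_ge0// ltW.
    ring.
  rewrite EFinM -sel_gain_Near_between//; last by rewrite divr_ge0// ltW.
  congr (P _ * _)%E; apply/seteqP; split => w /=; rewrite /C/= /b/=.
    by case/and3P => _ -> ->.
  by rewrite zAz.
rewrite (_ : _ @^-1` _ = set0) ?measure0 ?mul0e//.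
apply/seteqP; split => w //=; rewrite /C/= /b/= => /and3P[+ _ _].
by rewrite (negbTE zAz).
Qed.

End outage_probabilities.

Theorem theorem2 (R : realType) (s : noma_system R)
  (d : measure_display) (T : measurableType d) (P : probability T R)
  (h : forall U : user, 'I_(L_S s) -> 'I_(L_ s U) -> {RV P >-> R})
  (ihat : T -> 'I_(L_S s)) (RF RsN : R) :
  gains_gamma h ->
  gains_independent h ->
  solution_I h ihat ->
  0 < RF ->
  0 < RsN ->
  (gamma_th RF < beta s -> RsN <> eta s (gamma_th RF)) ->
  SOP_N h ihat (gamma_th RF) RsN =
  (if beta s <= gamma_th RF then 1
   else Lambda_1_I s (gamma_th RF) + Lambda_2_I s (gamma_th RF) RsN
        + Lambda_3_I s (gamma_th RF) RsN)%:E.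
Proof.
move=> gamma_h indep_h best RF0 RsN0 _.
set gth := gamma_th RF; have gth0 : 0 < gth by exact: gamma_th_gt0.
have g0 := gamma0_gt0 s; have gE := gammaE_gt0 s; have aN0 := alphaN_gt0 s.
have mY := measurable_sel_gain best Near; have mZ := measurable_sel_gain best Eve.
have mYF : measurable_fun setT (gamma_N_xF h ihat) by exact: measurable_snr_xF.
have mZF : measurable_fun setT (gamma_E_xF h ihat) by exact: measurable_snr_xF.
have mCN : measurable_fun setT (C_N h ihat).
  by apply: measurable_log2; apply: measurable_funD => //; exact: measurable_funM.
have mCS : measurable_fun setT (C_S h ihat).
  apply: measurable_maxr => //; apply: measurable_log2; apply: measurable_funM.
    by apply: measurable_funD => //; exact: measurable_funM.
  by apply: measurable_funV; apply: measurable_funD => //; exact: measurable_funM.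
(* The threshold equivalences assume positive gains, which holds only almost surely; the events
   below are compared up to a null set. *)
have pos := ae_sel_gain_gt0 ihat gamma_h indep_h.
have m1 : measurable [set w | gamma_N_xF h ihat w < gth] by exact: measurable_sublevel.
have mle := @measurable_superlevel R d T.
have m2 : measurable [set w | [/\ gth <= gamma_N_xF h ihat w,
    gamma_E_xF h ihat w < gth & C_N h ihat w < RsN]].
  rewrite (_ : [set _ | _] = [set w | gth <= gamma_N_xF h ihat w] `&`
    ([set w | gamma_E_xF h ihat w < gth] `&` [set w | C_N h ihat w < RsN])).
    by apply: measurableI; [exact: mle|apply: measurableI; exact: measurable_sublevel].
  by apply/seteqP; split => w /=; [move=> []|move=> [? []]].
have m3 : measurable [set w | [/\ gth <= gamma_N_xF h ihat w,
    gth <= gamma_E_xF h ihat w & C_S h ihat w < RsN]].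
  rewrite (_ : [set _ | _] = [set w | gth <= gamma_N_xF h ihat w] `&`
    ([set w | gth <= gamma_E_xF h ihat w] `&` [set w | C_S h ihat w < RsN])).
    apply: measurableI; first exact: mle.
    by apply: measurableI; [exact: mle|exact: measurable_sublevel].
  by apply/seteqP; split => w /=; [move=> []|move=> [? []]].
rewrite /SOP_N; have [bg|gb] := leP (beta s) gth.
  (* The ratio stays below [beta], hence below [gth]: the first event is almost sure and the other
     two are null. *)
  rewrite (@prob_ae_eq _ _ _ P _ setT)//; last first.
    apply: filterS pos => w [Y0 _]; split=> // _; apply: lt_le_trans bg.
    exact: snr_xF_lt_beta.
  rewrite probability_setT (@prob_ae_eq _ _ _ P _ set0)//; last first.
    apply: filterS pos => w [Y0 _]; split=> // -[/(le_trans bg) + _ _].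
    by rewrite leNgt => /negP; apply; exact: snr_xF_lt_beta.
  rewrite (@prob_ae_eq _ _ _ P [set w | _ ] set0)//; last first.
    apply: filterS pos => w [Y0 _]; split=> // -[/(le_trans bg) + _ _].
    by rewrite leNgt => /negP; apply; exact: snr_xF_lt_beta.
  by rewrite measure0 !adde0.
have A0 := A_gt0 gth0 gb.
have a0 : 0 <= A_ s gth / gamma0 s by rewrite divr_ge0// ltW.
have z0 : 0 <= A_ s gth / gammaE s by rewrite divr_ge0// ltW.
rewrite 2!EFinD; congr (_ + _ + _)%E.
- rewrite /Lambda_1_I -(sel_gain_Near_F_Y_I gamma_h indep_h best)//.
  apply: prob_ae_eq => //; first exact: measurable_sublevel.
  by apply: filterS pos => w [Y0 _] /=; rewrite /gamma_N_xF snr_xF_lt.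
- rewrite /Lambda_2_I lt_eta//; case: ifPn => [lt_A|].
    (* For [RsN < eta] the near gain would have to be at least [A_ / gamma0] and below the smaller
       [gamma_sN / gamma0]. *)
    rewrite (@prob_ae_eq _ _ _ P _ set0)// ?measure0//.
    apply: filterS pos => w [Y0 _]; split=> // -[].
    rewrite leNgt /gamma_N_xF /C_N /gamma_N_xN snr_xF_lt// log2_snr_xN_lt//.
    move=> /negP nle _ lt_g; apply: nle.
    by apply: lt_trans lt_g _; rewrite ltr_pM2r ?invr_gt0.
  rewrite -leNgt => le_A.
  rewrite -(sel_gain_between_lt gamma_h indep_h best)//; last by rewrite ler_pM2r ?invr_gt0.
  apply: prob_ae_eq => //.
    rewrite (_ : [set _ | _] = [set w | A_ s gth / gamma0 s <= sel_gain h ihat Near w] `&`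
      ([set w | sel_gain h ihat Near w < gamma_sN s RsN / gamma0 s] `&`
       [set w | sel_gain h ihat Eve w < A_ s gth / gammaE s])).
      by apply: measurableI; [exact: mle|apply: measurableI; exact: measurable_sublevel].
    by apply/seteqP; split => w /=; [move=> [/andP[]]|move=> [-> [-> ->]]].
  apply: filterS pos => w [Y0 Z0] /=.
  rewrite /gamma_N_xF /gamma_E_xF /C_N /gamma_N_xN leNgt !snr_xF_lt//.
  rewrite log2_snr_xN_lt// -leNgt.
  by split=> [[-> -> ->]|[/andP[-> ->] ->]].
- rewrite -(prob_Lambda_3_I gamma_h indep_h best gth0)//.
  apply: prob_ae_eq => //.
    (* The last condition compares two random quantities; their difference turns it into a sublevel
       set. *)
    rewrite (_ : [set _ | _] = [set w | A_ s gth / gammaE s <= sel_gain h ihat Eve w] `&`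
      ([set w | A_ s gth / gamma0 s <= sel_gain h ihat Near w] `&`
       [set w | sel_gain h ihat Near w - (gamma_sN s RsN / gamma0 s +
         2 `^ RsN * gammaE s / gamma0 s * sel_gain h ihat Eve w) < 0])).
      apply: measurableI; first exact: mle.
      apply: measurableI; first exact: mle.
      apply: measurable_sublevel; apply: measurable_funB => //.
      by apply: measurable_funD => //; exact: measurable_funM.
    by apply/seteqP; split => w /=; rewrite subr_lt0; [move=> []|move=> [? []]].
  apply: filterS pos => w [Y0 Z0] /=.
  rewrite /gamma_N_xF /gamma_E_xF /C_S /gamma_N_xN /gamma_E_xN.
  rewrite !leNgt !snr_xF_lt// secrecy_rate_lt//.
  by rewrite -!leNgt; split=> [[-> -> ->]|[-> -> ->]].
Qed.
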